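(* Let $V$ be a vector space over a field $\mathbf{k}$ of characteristic zero. There is a natural isomorphism $$\mathsf{L}(V)\cong\mathrm{Ker}\left(\delta:\mathrm{Tr}(V)\to\mathrm{Tr}^1(V)\right).$$
   Context: A pre-Lie algebra is a vector space $X$ with a bilinear product $\star$ whose associator $(x\star y)\star z-x\star(y\star z)$ is symmetric in $y,z$. $\mathsf{pL}(V)$ is the free pre-Lie algebra generated by $V$, and $\mathsf{L}(V)\subset \mathsf{pL}(V)$ is the Lie subalgebra generated by $V$ with respect to the commutator bracket $[x,y]=x\star y-y\star x$. Trees are finite, connected, simply connected graphs, rooted (one vertex is marked as the root), with edges oriented towards the root. The arity of a vertex is its number of incoming edges. $\mathrm{Tr}_n$ is the set of (isomorphism classes of) trees with $n$ vertices numbered $1,\dots,n$. Set $\mathrm{Tr}_n(V):=\mathrm{Span}_{\mathbf{k}}(\mathrm{Tr}_n)\otimes_{\Sigma_n}V^{\otimes n}$ (trees with $n$ vertices decorated by elements of $V$) and $\mathrm{Tr}(V):=\bigoplus_{n\ge1}\mathrm{Tr}_n(V)$. Similarly, let $\mathrm{Tr}^1_n$ be the set of trees with $n+1$ vertices, $n$ of them numbered $1,\dots,n$ and one, called the special vertex, labelled by a dummy symbol $\circ$ (the special vertex may or may not be the root); set $\mathrm{Tr}^1_n(V):=\mathrm{Span}_{\mathbf{k}}(\mathrm{Tr}^1_n)\otimes_{\Sigma_n}V^{\otimes n}$ and $\mathrm{Tr}^1(V):=\bigoplus_{n\ge0}\mathrm{Tr}^1_n(V)$. An edge $e$ of $S\in\mathrm{Tr}^1_n$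 is special if it is adjacent to the special vertex. For a special edge $e$, $S/e\in\mathrm{Tr}_n$ is obtained by contracting $e$ to a vertex and labelling this vertex by the label of the endpoint of $e$ different from the special vertex. For $T\in\mathrm{Tr}_n$, a blow-up of $T$ is a pair $(S,e)$ with $S\in\mathrm{Tr}^1_n$ and $e$ a special edge of $S$ such that $S/e\cong T$ and the special vertex of $S$ has arity $\ge2$; $\mathrm{bl}(T)$ is the set of all blow-ups of $T$. Put $\epsilon_{(S,e)}=+1$ if $e$ is an incoming edge of the special vertex and $\epsilon_{(S,e)}=-1$ if $e$ is its outgoing edge. The linear map $\delta:\mathrm{Tr}(V)\to\mathrm{Tr}^1(V)$ is induced by $\delta(T):=\sum_{(S,e)\in\mathrm{bl}(T)}\epsilon_{(S,e)}\,S$, with the decorations by elements of $V$ carried along. *)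

(* Defs.v *)
From HB Require Import structures.
From mathcomp Require Import all_boot all_order all_fingroup all_algebra.
From mathcomp Require Import generic_quotient boolp.
From mathcomp.multinomials Require Import freeg.

Set Implicit Arguments.
Unset Strict Implicit.
Unset Printing Implicit Defensive.

Import GRing.Theory.
Local Open Scope ring_scope.
Local Open Scope quotient_scope.

Section Subspace.
Variables (k : fieldType) (M : lmodType k) (S : submodClosed M).

Record subspace := Subspace { subspace_val : M; _ : subspace_val \in S }.

HB.instance Definition _ := [isSub for subspace_val].
HB.instance Definition _ := [Choice of subspace by <:].
HB.instance Definition _ := [SubChoice_isSubLmodule of subspace by <:].

(* {ideal_quot _} needs a zmodClosed predicate, which a submodClosed one is not
   canonically. *)
Definition zpred : {pred M} := fun x => x \in S.

Lemma zpred_closed : zmod_closed zpred.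
Proof. exact: GRing.submod_closedB (submodClosedP S). Qed.
HB.instance Definition _ := GRing.isZmodClosed.Build M zpred zpred_closed.

Definition quotmod : Type := {ideal_quot zpred}.

HB.instance Definition _ := GRing.Zmodule.on quotmod.

Definition pim (x : M) : quotmod := \pi_{ideal_quot zpred} x.
Definition quotmod_scale (a : k) (x : quotmod) : quotmod := pim (a *: repr x).

Lemma pim_eq x y : (pim x == pim y) = (x - y \in S).
Proof. exact: esym (Quotient.idealrBE zpred x y). Qed.

Lemma pimD x y : pim (x + y) = pim x + pim y.
Proof. exact: Quotient.pi_add. Qed.

Lemma repr_pim (x : quotmod) : pim (repr x) = x.
Proof. exact: reprK. Qed.

Lemma pim_scale a x : quotmod_scale a (pim x) = pim (a *: x).
Proof.
apply/eqP; rewrite pim_eq -scalerBr rpredZ //.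
by rewrite -pim_eq repr_pim.
Qed.

Lemma quotmod_scaleA a b v :
  quotmod_scale a (quotmod_scale b v) = quotmod_scale (a * b) v.
Proof. by rewrite -[v]repr_pim !pim_scale scalerA. Qed.
Lemma quotmod_scale1 : left_id 1 quotmod_scale.
Proof. by move=> v; rewrite -[v]repr_pim !pim_scale scale1r. Qed.
Lemma quotmod_scaleDr : right_distributive quotmod_scale +%R.
Proof.
by move=> a u v; rewrite -[u]repr_pim -[v]repr_pim -pimD !pim_scale scalerDr pimD.
Qed.
Lemma quotmod_scaleDl v : {morph quotmod_scale^~ v : a b / a + b}.
Proof. by move=> a b; rewrite -[v]repr_pim !pim_scale scalerDl pimD. Qed.

HB.instance Definition _ := GRing.Zmodule_isLmodule.Build k quotmod
  quotmod_scaleA quotmod_scale1 quotmod_scaleDr quotmod_scaleDl.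

Lemma pim_is_linear : linear pim.
Proof. by move=> a x y; rewrite pimD -pim_scale. Qed.
HB.instance Definition _ := GRing.isLinear.Build k M quotmod _ pim pim_is_linear.

Lemma pim_eq0 x : (pim x == 0) = (x \in S).
Proof. by rewrite -(linear0 pim) pim_eq subr0. Qed.

End Subspace.

Section Span.
Variables (k : fieldType) (M : lmodType k) (A : M -> Prop).

Definition lspan : {pred M} := fun x =>
  `[< forall S : submodClosed M, (forall y, A y -> y \in S) -> x \in S >].

Lemma lspan_submod_closed : submod_closed lspan.
Proof.
split=> [|a x y /asboolP Hx /asboolP Hy]; apply/asboolP => S HS; first exact: rpred0.
by rewrite rpredD ?rpredZ ?Hx ?Hy.
Qed.
HB.instance Definition _ := GRing.isSubmodClosed.Build k M lspan lspan_submod_closed.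

Lemma mem_lspan x : A x -> x \in lspan.
Proof. by move=> Ax; apply/asboolP => S; apply. Qed.
End Span.

Section Kernel.
Variables (k : fieldType) (M N : lmodType k) (f : {linear M -> N}).

Definition kernel : {pred M} := fun x => f x == 0.

Lemma kernel_submod_closed : submod_closed kernel.
Proof.
split=> [|a x y /eqP fx /eqP fy]; apply/eqP; rewrite ?linear0 //.
by rewrite linearP fx fy scaler0 addr0.
Qed.
HB.instance Definition _ := GRing.isSubmodClosed.Build k M kernel kernel_submod_closed.

Definition lpreim (S : submodClosed N) : {pred M} := fun x => f x \in S.

Lemma mem_lpreim (S : submodClosed N) x : (x \in lpreim S) = (f x \in S).
Proof. exact: erefl. Qed.

Lemma lpreim_submod_closed S : submod_closed (lpreim S).
Proof.
split=> [|a x y]; rewrite !mem_lpreim ?linear0 ?rpred0 // => fx fy.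
by rewrite linearP rpredD ?rpredZ.
Qed.
HB.instance Definition _ S :=
  GRing.isSubmodClosed.Build k M (lpreim S) (lpreim_submod_closed S).
End Kernel.

Section QuotLift.
Variables (k : fieldType) (M N : lmodType k) (S : submodClosed M).
Variables (f : {linear M -> N}) (fS : forall x, x \in S -> f x = 0).

Definition quot_lift of (forall x, x \in S -> f x = 0) :=
  fun x : quotmod S => f (repr x).

Lemma quot_liftE x : quot_lift fS (pim S x) = f x.
Proof. by apply/eqP; rewrite -subr_eq0 -linearB fS // -pim_eq repr_pim. Qed.

Lemma quot_lift_is_linear : linear (quot_lift fS).
Proof.
move=> a x y; rewrite -[x]repr_pim -[y]repr_pim -linearP !quot_liftE.
exact: linearP.
Qed.
HB.instance Definition _ :=
  GRing.isLinear.Build k _ _ _ (quot_lift fS) quot_lift_is_linear.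
End QuotLift.
Arguments quot_lift : simpl never.

Section FreeModule.
Variables (k : fieldType) (G : choiceType).

Definition fgen (g : G) : {freeg G / k} := Freeg [:: (1, g)].

Lemma freeg_gen_ind (P : {freeg G / k} -> Prop) :
  P 0 -> (forall a g x, P x -> P (a *: fgen g + x)) -> forall x, P x.
Proof.
move=> P0 PS; apply: freeg_ind_dom0 => // a g y _ _ Py.
have -> : Freeg [:: (a, g)] = a *: fgen g.
  by apply/eqP/freeg_eqP => h; rewrite coeffZ !coeffU mul1r.
exact: PS.
Qed.

Variables (M : lmodType k) (f : G -> M).

Lemma fglift_is_linear : linear (fglift f : {freeg G / k} -> M).
Proof.
have fg0 : fglift f (0 : {freeg G / k}) = 0.
  by have := lift_is_additive f 0 0; rewrite subrr => ->; rewrite subrr.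
have fgD (x y : {freeg G / k}) : fglift f (x + y) = fglift f x + fglift f y.
  rewrite -[y in LHS]opprK (lift_is_additive f x (- y)) -[- y]sub0r.
  by rewrite (lift_is_additive f 0 y) fg0 sub0r opprK.
have fgZ a (x : {freeg G / k}) : fglift f (a *: x) = a *: fglift f x.
  have e (b : k) g : b *: fgen g = Freeg [:: (b, g)].
    by apply/eqP/freeg_eqP => h; rewrite coeffZ !coeffU mul1r.
  elim/freeg_gen_ind: x => [|b g x IH]; first by rewrite scaler0 fg0 scaler0.
  by rewrite scalerDr !fgD IH scalerDr scalerA !e !liftU scalerA.
by move=> a x y; rewrite fgD fgZ.
Qed.

Definition free_lift (x : {freeg G / k}) : M := fglift f x.
HB.instance Definition _ := GRing.isLinear.Build k _ _ _ free_lift fglift_is_linear.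

Lemma free_liftE g : free_lift (fgen g) = f g.
Proof. by rewrite /free_lift liftU scale1r. Qed.
End FreeModule.
Arguments free_lift : simpl never.

HB.mixin Record Lmodule_isPreLie (k : fieldType) A of GRing.Lmodule k A := {
  pstar : A -> A -> A;
  pstar_linearl : forall y, linear (pstar^~ y);
  pstar_linearr : forall x, linear (pstar x);
  pstar_assoc_sym : forall x y z,
    pstar (pstar x y) z - pstar x (pstar y z)
    = pstar (pstar x z) y - pstar x (pstar z y)
}.

#[short(type="preLieType")]
HB.structure Definition PreLie (k : fieldType) :=
  { A of GRing.Lmodule k A & Lmodule_isPreLie k A }.

Lemma pstar0l (k : fieldType) (A : preLieType k) (y : A) : pstar 0 y = 0.
Proof.
by have := pstar_linearl y (-1) 0 0; rewrite scaler0 addr0 scaleN1r addNr.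
Qed.

Lemma pstar0r (k : fieldType) (A : preLieType k) (x : A) : pstar x 0 = 0.
Proof.
by have := pstar_linearr x (-1) 0 0; rewrite scaler0 addr0 scaleN1r addNr.
Qed.

Definition lie_bracket (k : fieldType) (A : preLieType k) (x y : A) : A :=
  pstar x y - pstar y x.

Section LieSubalgebra.
Variables (k : fieldType) (A : preLieType k) (B : A -> Prop).

Definition lie_closed (S : {pred A}) :=
  forall x y, x \in S -> y \in S -> lie_bracket x y \in S.

Definition lie_span : {pred A} := fun x =>
  `[< forall S : submodClosed A,
        lie_closed S -> (forall y, B y -> y \in S) -> x \in S >].

Lemma lie_span_submod_closed : submod_closed lie_span.
Proof.
split=> [|a x y /asboolP Hx /asboolP Hy]; apply/asboolP => S HS BS.
  exact: rpred0.
by rewrite rpredD ?rpredZ ?Hx ?Hy.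
Qed.
HB.instance Definition _ :=
  GRing.isSubmodClosed.Build k A lie_span lie_span_submod_closed.

Lemma lie_span_closed : lie_closed lie_span.
Proof.
move=> x y /asboolP Hx /asboolP Hy; apply/asboolP => S HS BS.
by apply: (HS); [apply: Hx | apply: Hy].
Qed.

Lemma mem_lie_span x : B x -> x \in lie_span.
Proof. by move=> Bx; apply/asboolP => S _; apply. Qed.
End LieSubalgebra.

(* The free pre-Lie algebra on a vector space, as the quotient of the free
   nonassociative algebra on the set V by the two-sided ideal generated by the
   linearity of V -> pL(V) and by the pre-Lie identity *)

Inductive magma (V : Type) := Leaf of V | Node of magma V & magma V.

HB.instance Definition _ V := gen_eqMixin (magma V).
HB.instance Definition _ V := gen_choiceMixin (magma V).

Section FreePreLie.
Variables (k : fieldType) (V : lmodType k).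

Local Notation F := {freeg (magma V) / k}.
Local Notation leaf v := (fgen k (Leaf v)).

Definition mmul (x y : F) : F :=
  free_lift (fun s => free_lift (fun t => fgen k (Node s t)) y) x.

Definition massoc (x y z : F) : F := mmul (mmul x y) z - mmul x (mmul y z).

Inductive preLie_relator : F -> Prop :=
| PL_linear (a : k) (u v : V) :
    preLie_relator (leaf (a *: u + v) - (a *: leaf u + leaf v))
| PL_preLie (x y z : F) : preLie_relator (massoc x y z - massoc x z y).

Definition mideal_closed (S : {pred F}) :=
  forall x y, x \in S -> mmul x y \in S /\ mmul y x \in S.

Definition preLie_ideal : {pred F} := fun x =>
  `[< forall S : submodClosed F,
        mideal_closed S -> (forall y, preLie_relator y -> y \in S) -> x \in S >].

Lemma preLie_ideal_submod_closed : submod_closed preLie_ideal.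
Proof.
split=> [|a x y /asboolP Hx /asboolP Hy]; apply/asboolP => S HS BS.
  exact: rpred0.
by rewrite rpredD ?rpredZ ?Hx ?Hy.
Qed.
HB.instance Definition _ :=
  GRing.isSubmodClosed.Build k F preLie_ideal preLie_ideal_submod_closed.

Lemma preLie_ideal_closed : mideal_closed preLie_ideal.
Proof.
move=> x y /asboolP Hx; split; apply/asboolP => S HS BS.
  by case: (HS x y (Hx S HS BS)).
by case: (HS x y (Hx S HS BS)).
Qed.

Lemma mem_preLie_ideal x : preLie_relator x -> x \in preLie_ideal.
Proof. by move=> Bx; apply/asboolP => S _; apply. Qed.

Definition pL : Type := quotmod preLie_ideal.
HB.instance Definition _ := GRing.Lmodule.on pL.

Lemma mmul_linearl y : linear (mmul^~ y).
Proof. by move=> a u v; rewrite /mmul linearP. Qed.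

Lemma mmul_linearr x : linear (mmul x).
Proof.
move=> a u v; elim/freeg_gen_ind: x => [|b g x IH].
  by rewrite /mmul !linear0 addr0.
rewrite !mmul_linearl IH /mmul !free_liftE linearP !scalerDr !scalerA.
by rewrite (mulrC b) -!addrA; congr (_ + _); rewrite addrCA.
Qed.

Definition pLi (v : V) : pL := pim preLie_ideal (leaf v).

Lemma pLi_is_linear : linear pLi.
Proof.
move=> a u v; rewrite /pLi -linearP; apply/eqP; rewrite pim_eq.
exact/mem_preLie_ideal/PL_linear.
Qed.
HB.instance Definition _ := GRing.isLinear.Build k V pL _ pLi pLi_is_linear.

Definition pL_star (x y : pL) : pL := pim preLie_ideal (mmul (repr x) (repr y)).

Lemma pL_starE x y :
  pL_star (pim preLie_ideal x) (pim preLie_ideal y) = pim preLie_ideal (mmul x y).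
Proof.
have mulBl u v w : mmul (u - v) w = mmul u w - mmul v w.
  by have := mmul_linearl w (-1) v u; rewrite !scaleN1r !(addrC (- _)).
have mulBr u v w : mmul w (u - v) = mmul w u - mmul w v.
  by have := mmul_linearr w (-1) v u; rewrite !scaleN1r !(addrC (- _)).
apply/eqP; rewrite pim_eq; set x' := repr _; set y' := repr _.
rewrite -(subrKA (mmul x y')) -mulBl -mulBr rpredD //.
  have xx : x' - x \in preLie_ideal by rewrite -pim_eq repr_pim.
  by case: (preLie_ideal_closed y' xx).
have yy : y' - y \in preLie_ideal by rewrite -pim_eq repr_pim.
by case: (preLie_ideal_closed x yy).
Qed.

Lemma pL_star_linearl y : linear (pL_star^~ y).
Proof.
move=> a u v; rewrite -[y]repr_pim -[u]repr_pim -[v]repr_pim -linearP !pL_starE.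
by rewrite mmul_linearl linearP.
Qed.
Lemma pL_star_linearr x : linear (pL_star x).
Proof.
move=> a u v; rewrite -[x]repr_pim -[u]repr_pim -[v]repr_pim -linearP !pL_starE.
by rewrite mmul_linearr linearP.
Qed.
Lemma pL_star_assoc_sym x y z :
  pL_star (pL_star x y) z - pL_star x (pL_star y z)
  = pL_star (pL_star x z) y - pL_star x (pL_star z y).
Proof.
rewrite -[x]repr_pim -[y]repr_pim -[z]repr_pim !pL_starE -!linearB.
by apply/eqP; rewrite pim_eq; apply/mem_preLie_ideal/PL_preLie.
Qed.

HB.instance Definition _ := Lmodule_isPreLie.Build k pL
  pL_star_linearl pL_star_linearr pL_star_assoc_sym.

Section Lift.
Variables (A : preLieType k) (f : {linear V -> A}).

Fixpoint magma_eval (t : magma V) : A :=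
  match t with
  | Leaf v => f v
  | Node s t => pstar (magma_eval s) (magma_eval t)
  end.

Lemma magma_evalM x y :
  free_lift magma_eval (mmul x y)
  = pstar (free_lift magma_eval x) (free_lift magma_eval y) :> A.
Proof.
elim/freeg_gen_ind: x => [|a s x IH]; first by rewrite /mmul !linear0 pstar0l.
rewrite mmul_linearl !linearP /= IH pstar_linearl; congr (a *: _ + _).
rewrite /mmul !free_liftE; elim/freeg_gen_ind: y {IH} => [|b t y IH].
  by rewrite !linear0 pstar0r.
by rewrite !linearP /= IH pstar_linearr !free_liftE.
Qed.

Lemma magma_eval_ideal x : x \in preLie_ideal -> free_lift magma_eval x = 0 :> A.
Proof.
move=> /asboolP/(_ (kernel (free_lift magma_eval : {linear F -> A}))) H; apply/eqP/H.
  move=> u v /eqP /= hu; split; apply/eqP; rewrite /= magma_evalM hu.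
    exact: pstar0l.
  exact: pstar0r.
move=> _ [a u v | u v w]; apply/eqP.
  by rewrite linearB linearP /= !free_liftE /= linearP subrr.
by rewrite linearB /massoc !(linearB (free_lift _)) /= !magma_evalM pstar_assoc_sym subrr.
Qed.

Definition pL_lift : {linear pL -> A} := quot_lift magma_eval_ideal.

Lemma pL_liftE x : pL_lift (pim preLie_ideal x) = free_lift magma_eval x.
Proof. exact: quot_liftE. Qed.

Lemma pL_lift_gen v : pL_lift (pLi v) = f v.
Proof. by rewrite pL_liftE free_liftE. Qed.

Lemma pL_lift_star x y : pL_lift (pstar x y) = pstar (pL_lift x) (pL_lift y).
Proof.
rewrite -[x]repr_pim -[y]repr_pim [pstar _ _]pL_starE !pL_liftE.
exact: magma_evalM.
Qed.

Lemma pL_lift_unique (g : {linear pL -> A}) :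
  (forall v, g (pLi v) = f v) ->
  (forall x y, g (pstar x y) = pstar (g x) (g y)) ->
  g =1 pL_lift.
Proof.
move=> gi gs x; rewrite -[x]repr_pim.
elim/freeg_gen_ind: (repr x) => [|a t y IH]; first by rewrite !linear0.
rewrite !linearP /= IH; congr (a *: _ + _).
elim: t => [v|s IHs t IHt]; first by rewrite -/(pLi v) gi -pL_lift_gen.
have -> : fgen k (Node s t) = mmul (fgen k s) (fgen k t).
  by rewrite /mmul !free_liftE.
by rewrite -pL_starE [LHS]gs [RHS]pL_lift_star IHs IHt.
Qed.
End Lift.

Definition L : {pred pL} := lie_span (fun x => exists v, x = pLi v).
HB.instance Definition _ := GRing.SubmodClosed.on L.

End FreePreLie.
Arguments pL_lift : simpl never.

Section FreePreLieMap.
Variables (k : fieldType) (V W : lmodType k) (f : {linear V -> W}).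

Definition pL_map : {linear pL V -> pL W} :=
  pL_lift (@pLi k W \o f : {linear V -> pL W}).

Lemma pL_map_gen v : pL_map (pLi v) = pLi (f v).
Proof. exact: pL_lift_gen. Qed.

Lemma pL_map_star x y : pL_map (pstar x y) = pstar (pL_map x) (pL_map y).
Proof. exact: pL_lift_star. Qed.

Lemma pL_map_L x : x \in @L k V -> pL_map x \in @L k W.
Proof.
move=> /asboolP/(_ (lpreim pL_map (@L k W))) H.
rewrite -mem_lpreim; apply: H.
  move=> u v; rewrite !mem_lpreim => Su Sv.
  by rewrite /lie_bracket linearB !pL_map_star; apply: lie_span_closed.
move=> _ [v ->]; rewrite mem_lpreim pL_map_gen.
by apply: mem_lie_span; exists (f v).
Qed.

Definition L_map (x : subspace (@L k V)) : subspace (@L k W) :=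
  Subspace (pL_map_L (valP x)).
End FreePreLieMap.
Arguments pL_map : simpl never.

(* Decorated structures: the direct sum over n of the coinvariant spaces
   Span(X n) (x)_{Sigma_n} V^{(x) n}, presented by generators (T; v_1, .., v_n)
   and by the relations expressing multilinearity and Sigma_n-balancedness *)

Section Decorated.
Variables (k : fieldType) (X : nat -> finType).
Variable to : forall n, {action {perm 'I_n} &-> X n}.

Section Space.
Variable V : lmodType k.

Definition decoration : choiceType := {n : nat & (X n * {ffun 'I_n -> V})%type}.

Definition dgen n (T : X n) (v : {ffun 'I_n -> V}) : {freeg decoration / k} :=
  fgen k (existT (fun n => (X n * {ffun 'I_n -> V})%type) n (T, v) : decoration).

Definition upd n (v : {ffun 'I_n -> V}) i (u : V) : {ffun 'I_n -> V} :=
  [ffun j => if j == i then u else v j].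

(* the point j of T becomes the point s j of to n T s *)
Inductive deco_relator : {freeg decoration / k} -> Prop :=
| D_linear n (T : X n) v i (a : k) (u w : V) :
    deco_relator (dgen T (upd v i (a *: u + w))
                  - (a *: dgen T (upd v i u) + dgen T (upd v i w)))
| D_balanced n (T : X n) v (s : {perm 'I_n}) :
    deco_relator (dgen (to n T s) v - dgen T [ffun j => v (s j)]).

Definition decorated : Type := quotmod (lspan deco_relator).
HB.instance Definition _ := GRing.Lmodule.on decorated.

Definition deco n (T : X n) (v : {ffun 'I_n -> V}) : decorated :=
  pim (lspan deco_relator) (dgen T v).

Lemma deco_linear n (T : X n) v i (a : k) (u w : V) :
  deco T (upd v i (a *: u + w)) = a *: deco T (upd v i u) + deco T (upd v i w).
Proof.
by rewrite /deco -linearP; apply/eqP; rewrite pim_eq; apply/mem_lspan/D_linear.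
Qed.

Lemma deco_balanced n (T : X n) v (s : {perm 'I_n}) :
  deco (to n T s) v = deco T [ffun j => v (s j)].
Proof. by apply/eqP; rewrite pim_eq; apply/mem_lspan/D_balanced. Qed.

Section Lift.
Variables (M : lmodType k) (f : forall n, X n -> {ffun 'I_n -> V} -> M).
Hypothesis f_linear : forall n (T : X n) v i (a : k) (u w : V),
  f T (upd v i (a *: u + w)) = a *: f T (upd v i u) + f T (upd v i w).
Hypothesis f_balanced : forall n (T : X n) v (s : {perm 'I_n}),
  f (to n T s) v = f T [ffun j => v (s j)].

Let f' (d : decoration) : M := f (tagged d).1 (tagged d).2.

Lemma deco_lift_subproof x : x \in lspan deco_relator -> free_lift f' x = 0.
Proof.
move=> /asboolP/(_ (kernel (free_lift f'))) H; apply/eqP/H => _ [] *; apply/eqP.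
  by rewrite linearB linearP /= !free_liftE /f' /= f_linear subrr.
by rewrite linearB /= !free_liftE /f' /= f_balanced subrr.
Qed.

Definition deco_lift : {linear decorated -> M} := quot_lift deco_lift_subproof.

Lemma deco_liftE n (T : X n) v : deco_lift (deco T v) = f T v.
Proof. exact: etrans (quot_liftE _ _) (free_liftE _ _). Qed.
End Lift.

Lemma deco_ext (M : lmodType k) (f g : {linear decorated -> M}) :
  (forall n (T : X n) v, f (deco T v) = g (deco T v)) -> f =1 g.
Proof.
move=> fg x; rewrite -[x]repr_pim.
elim/freeg_gen_ind: (repr x) => [|a [n [T v]] y IH]; first by rewrite !linear0.
by rewrite !linearP /= IH [X in a *: X + _](fg n T v).
Qed.
End Space.

Section Map.
Variables (V W : lmodType k) (f : {linear V -> W}).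

Let g n (T : X n) (v : {ffun 'I_n -> V}) := deco T [ffun j => f (v j)].

Lemma deco_map_linear n (T : X n) v i (a : k) (u w : V) :
  g T (upd v i (a *: u + w)) = a *: g T (upd v i u) + g T (upd v i w).
Proof.
have E z : [ffun j => f (upd v i z j)] = upd [ffun j => f (v j)] i (f z).
  by apply/ffunP => j; rewrite !ffunE; case: eqP.
by rewrite /g !E linearP deco_linear.
Qed.

Lemma deco_map_balanced n (T : X n) v (s : {perm 'I_n}) :
  g (to n T s) v = g T [ffun j => v (s j)].
Proof.
by rewrite /g deco_balanced; congr deco; apply/ffunP => j; rewrite !ffunE.
Qed.

Definition deco_map : {linear decorated V -> decorated W} :=
  deco_lift deco_map_linear deco_map_balanced.

Lemma deco_mapE n (T : X n) v : deco_map (deco T v) = deco T [ffun j => f (v j)].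
Proof. exact: deco_liftE. Qed.
End Map.
End Decorated.
Arguments deco_lift : simpl never.
Arguments deco_map : simpl never.

(* Rooted trees, encoded by their parent function: the outgoing edge of x
   leads to p x, and the root is the vertex r with p r = None *)

Definition is_rtree (T : finType) (p : {ffun T -> option T}) :=
  [exists r, (p r == None) && [forall x, connect (fun a b => p a == Some b) x r]].

Definition rtree (T : finType) := {p : {ffun T -> option T} | is_rtree p}.
HB.instance Definition _ (T : finType) := Finite.on (rtree T).

Definition parent (T : finType) (t : rtree T) : T -> option T := val t.

Section Relabel.
Variable T : finType.

Definition relabel_fun (p : {ffun T -> option T}) (s : {perm T}) :
  {ffun T -> option T} := [ffun x => omap s (p (s^-1%g x))].

Lemma is_rtree_relabel p s : is_rtree p -> is_rtree (relabel_fun p s).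
Proof.
case/existsP=> r /andP[/eqP pr /forallP cr]; apply/existsP; exists (s r).
rewrite ffunE permK pr eqxx; apply/forallP => x; rewrite -[x](permKV s).
case/connectP: (cr (s^-1%g x)) => q pq lq; apply/connectP; exists (map s q).
  move: (s^-1%g x) pq {lq} => y; elim: q y => //= z q IH y /andP[/eqP yz /IH ->].
  by rewrite ffunE permK yz /= eqxx.
by rewrite last_map -lq.
Qed.

Definition relabel (t : rtree T) (s : {perm T}) : rtree T :=
  exist _ (relabel_fun (val t) s) (is_rtree_relabel s (valP t)).

Lemma parent_relabel t s x : parent (relabel t s) x = omap s (parent t (s^-1%g x)).
Proof. by rewrite /parent ffunE. Qed.

Lemma rtreeP (t u : rtree T) : parent t =1 parent u -> t = u.
Proof. by move=> E; apply/val_inj/ffunP. Qed.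

Lemma parent_neq (t : rtree T) x : parent t x != Some x.
Proof.
apply/eqP => tx; have /existsP[r /andP[/eqP tr /forallP/(_ x)/connectP[q]]] := valP t.
have loop : forall q, path (fun a b => val t a == Some b) x q -> last x q = x.
  elim=> //= z {}q IH /andP[/eqP tz tq]; have E : z = x.
    by move: tz; rewrite -/(parent t x) tx => -[].
  by rewrite E in tq *; apply: IH.
by move=> /loop -> rx; move: tr; rewrite -/(parent t r) rx tx.
Qed.

Lemma relabel1 t : relabel t 1 = t.
Proof.
apply: rtreeP => x; rewrite parent_relabel invg1 perm1.
by case: parent => //= y; rewrite perm1.
Qed.

Lemma relabelM t s s' : relabel t (s * s') = relabel (relabel t s) s'.
Proof.
apply: rtreeP => x; rewrite !parent_relabel invMg permM.
by case: parent => //= y; rewrite permM.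
Qed.

Lemma oext_inj (s : {perm T}) : injective (omap s).
Proof. by move=> [x|] [y|] //= [/perm_inj ->]. Qed.

Definition oext (s : {perm T}) : {perm option T} := perm (@oext_inj s).

Lemma oext1 : oext 1 = 1%g.
Proof. by apply/permP => -[x|]; rewrite permE /= !perm1. Qed.

Lemma oextM s s' : oext (s * s') = (oext s * oext s')%g.
Proof. by apply/permP => -[x|]; rewrite permM !permE //= permM. Qed.

Lemma oextV s : (oext s)^-1%g = oext s^-1.
Proof. by apply/eqP; rewrite eq_invg_mul -oextM mulgV oext1. Qed.

End Relabel.

(* Trees with n vertices labelled by 'I_n; there are none for n = 0. *)
Definition Tree (n : nat) : finType := rtree 'I_n.

(* Trees with n + 1 vertices, None being the special vertex. *)
Definition Tree1 (n : nat) : finType := rtree (option 'I_n).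

Definition tree_act n : {action {perm 'I_n} &-> Tree n} :=
  TotalAction (@relabel1 'I_n) (@relabelM 'I_n).

Definition relabel_o n (S : Tree1 n) (s : {perm 'I_n}) : Tree1 n :=
  relabel S (oext s).

Lemma relabel_o1 n (S : Tree1 n) : relabel_o S 1 = S.
Proof. by rewrite /relabel_o oext1 relabel1. Qed.

Lemma relabel_oM n (S : Tree1 n) s s' :
  relabel_o S (s * s') = relabel_o (relabel_o S s) s'.
Proof. by rewrite /relabel_o oextM relabelM. Qed.

Definition tree1_act n : {action {perm 'I_n} &-> Tree1 n} :=
  TotalAction (@relabel_o1 n) (@relabel_oM n).

Definition Tr (k : fieldType) (V : lmodType k) := decorated tree_act V.
Definition Tr1 (k : fieldType) (V : lmodType k) := decorated tree1_act V.

HB.instance Definition _ k V := GRing.Lmodule.on (@Tr k V).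
HB.instance Definition _ k V := GRing.Lmodule.on (@Tr1 k V).

(* An edge is the pair (x, y) of its tail x and its head y. *)
Definition edges (T : finType) (t : rtree T) : {set T * T} :=
  [set e | parent t e.1 == Some e.2].

Definition arity (T : finType) (t : rtree T) (x : T) : nat :=
  #|[set y | parent t y == Some x]|.

Section BlowUp.
Variable n : nat.

Definition special (e : option 'I_n * option 'I_n) : bool :=
  (e.1 == None) || (e.2 == None).

(* The image of x under the contraction of e, i.e. the special vertex is
   identified with the other endpoint of e. *)
Definition collapse (e : option 'I_n * option 'I_n) (x : option 'I_n) :
    option 'I_n :=
  if x is Some _ then x else if e.1 is Some _ then e.1 else e.2.

(* The parent function of S / e.  The edge leaving the vertex obtained by
   contracting e is the edge leaving the head of e. *)
Definition contract (S : Tree1 n) (e : option 'I_n * option 'I_n) :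
    {ffun 'I_n -> option 'I_n} :=
  [ffun j => obind (collapse e)
               (parent S (if Some j == e.1 then e.2 else Some j))].

Lemma contract_collapse S e a j : special e -> a != e.1 ->
  collapse e a = Some j -> contract S e j = obind (collapse e) (parent S a).
Proof.
case: e => e1 e2; rewrite /special ffunE => /= se; case: a => [a|] /= ae.
  by case=> <-; rewrite (negPf ae).
case: e1 ae se => // i _ /= /eqP -> [->].
by rewrite eqxx.
Qed.

Lemma is_rtree_contract S e :
  e \in edges S -> special e -> is_rtree (contract S e).
Proof.
rewrite inE => /eqP pe se.
have cS a : exists j, collapse e a = Some j.
  case: e pe se => -[i|] [j|] pe // _; case: a => [l|] /=; try by eexists.
  by have := parent_neq S None; rewrite [parent _ _]pe eqxx.
have /existsP[r /andP[/eqP pr /forallP cr]] := valP S.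
have [r' er] := cS r; apply/existsP; exists r'; apply/andP; split.
  rewrite (@contract_collapse S e r) //; first by rewrite /parent pr.
  by apply: contra_eqN pe => /eqP <-; rewrite /parent pr.
apply/forallP => x; have /connectP[q pq lq] := cr (Some x).
suff main : forall q a j, path (fun a b => val S a == Some b) a q ->
    r = last a q -> collapse e a = Some j ->
    connect (fun a b => contract S e a == Some b) j r'.
  exact: main pq lq _.
elim=> [|b p IH] a j /=.
  by move=> _ <-; rewrite er => -[->]; apply: connect0.
move=> /andP[/eqP ab pp] lp ca; have [b' cb] := cS b.
have [ae|ae] := eqVneq a e.1; last first.
  apply: connect_trans (IH b b' pp lp cb); apply: connect1.
  by rewrite (contract_collapse S se ae ca) /parent ab /= cb.
have be : b = e.2 by move: pe; rewrite -ae /parent ab => -[].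
apply: IH pp lp _; rewrite -ca ae be.
by move: se; rewrite /special; case: (e) => -[i|] [l|].
Qed.

(* An isomorphism S / e ~ T preserves the labels 'I_n, so it is an equality of
   parent functions. *)
Definition bl (T : Tree n) : {set Tree1 n * (option 'I_n * option 'I_n)} :=
  [set b | [&& b.2 \in edges b.1, special b.2, contract b.1 b.2 == val T
             & (2 <= arity b.1 None)%N]].

Section BlRelabel.
Variable s : {perm 'I_n}.

Lemma parent_oext (S : Tree1 n) x :
  parent (relabel_o S s) (omap s x) = omap (omap s) (parent S x).
Proof.
rewrite parent_relabel -[omap s x]/((fun y => omap s y) x).
have -> : omap s x = oext s x by rewrite permE.
by rewrite permK; case: parent => //= y; rewrite permE.
Qed.

Definition bl_relabel (b : Tree1 n * (option 'I_n * option 'I_n)) :=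
  (relabel_o b.1 s, (omap s b.2.1, omap s b.2.2)).

Lemma collapse_relabel e x :
  collapse (omap s e.1, omap s e.2) (omap s x) = omap s (collapse e x).
Proof. by case: e x => -[i|] [j|] [x|]. Qed.

Lemma contract_relabel S e :
  contract (relabel_o S s) (omap s e.1, omap s e.2)
  = relabel_fun (contract S e) s.
Proof.
apply/ffunP => y; rewrite -[y](permKV s); set j := (s^-1%g y).
rewrite !ffunE permK /= -[Some (s j)]/(omap s (Some j)) (inj_eq (@oext_inj _ s)).
rewrite -(fun_if (omap s)) parent_oext; case: parent => //= x.
exact: collapse_relabel.
Qed.

Lemma relabel_fun_inj (U : finType) (t : {perm U}) : 
  injective (fun p : {ffun U -> option U} => relabel_fun p t).
Proof.
move=> p q /ffunP pq; apply/ffunP => x; have := pq (t x).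
by rewrite !ffunE permK => /oext_inj.
Qed.

Lemma arity_relabel S : arity (relabel_o S s) None = arity S None.
Proof.
rewrite /arity -[RHS](card_imset _ (@oext_inj _ s)); apply: eq_card => y.
apply/idP/imsetP => [|[x + ->]]; rewrite !inE; last first.
  by rewrite parent_oext => /eqP ->.
have -> : y = omap s (omap s^-1%g y) by case: y => //= y; rewrite permKV.
rewrite parent_oext => py; exists (omap s^-1%g y) => //.
by rewrite inE; case: parent py => [[]|].
Qed.

Lemma mem_bl_relabel (T : Tree n) b :
  (bl_relabel b \in bl (tree_act n T s)) = (b \in bl T).
Proof.
case: b => S e; rewrite !inE /= arity_relabel contract_relabel parent_oext.
congr [&& _, _, _ & _].
- rewrite -[Some (omap s e.2)]/(omap (omap s) (Some e.2)).
  by apply: inj_eq => -[x|] [y|] // [/oext_inj ->].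
- by rewrite /special; case: e => -[?|] [?|].
- by rewrite (inj_eq (@relabel_fun_inj _ s)).
Qed.

Lemma bl_relabel_inj : injective bl_relabel.
Proof.
move=> [S [x y]] [S' [x' y']] [E /oext_inj -> /oext_inj ->]; congr (_, _).
by apply: val_inj; apply: relabel_fun_inj E.
Qed.
End BlRelabel.
End BlowUp.

Section Delta.
Variable k : fieldType.

(* The sign is 1 when the special vertex is the head of the edge, i.e. when the
   edge is incoming. *)
Definition bl_sign n (b : Tree1 n * (option 'I_n * option 'I_n)) : k :=
  if b.2.2 == None then 1 else -1.

Section DeltaV.
Variable V : lmodType k.

Definition delta_gen n (T : Tree n) (v : {ffun 'I_n -> V}) : Tr1 V :=
  \sum_(b in bl T) bl_sign b *: (deco tree1_act b.1 v : Tr1 V).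

Lemma delta_gen_linear n (T : Tree n) v i (a : k) (u w : V) :
  delta_gen T (upd v i (a *: u + w))
  = a *: delta_gen T (upd v i u) + delta_gen T (upd v i w).
Proof.
rewrite /delta_gen scaler_sumr -big_split; apply: eq_bigr => b _.
by rewrite (deco_linear tree1_act) scalerDr !scalerA (mulrC a).
Qed.

Lemma delta_gen_balanced n (T : Tree n) v (s : {perm 'I_n}) :
  delta_gen (tree_act n T s) v = delta_gen T [ffun j => v (s j)].
Proof.
rewrite /delta_gen (reindex_inj (@bl_relabel_inj n s)).
apply: eq_big => [b|b _]; first exact: mem_bl_relabel.
rewrite -(deco_balanced tree1_act b.1 v s); congr (_ *: _).
by rewrite /bl_sign /=; case: b.2.2.
Qed.

Definition delta : {linear Tr V -> Tr1 V} :=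
  deco_lift delta_gen_linear delta_gen_balanced.

Lemma deltaE n (T : Tree n) v : delta (deco tree_act T v) = delta_gen T v.
Proof. exact: deco_liftE. Qed.
End DeltaV.
Arguments delta : simpl never.

Section DeltaMap.
Variables (V W : lmodType k) (f : {linear V -> W}).

Definition Tr_map : {linear Tr V -> Tr W} := deco_map tree_act f.
Definition Tr1_map : {linear Tr1 V -> Tr1 W} := deco_map tree1_act f.

Lemma Tr_mapE n (T : Tree n) v :
  Tr_map (deco tree_act T v) = deco tree_act T [ffun j => f (v j)].
Proof. exact: deco_mapE. Qed.

Lemma Tr1_mapE n (S : Tree1 n) v :
  Tr1_map (deco tree1_act S v) = deco tree1_act S [ffun j => f (v j)].
Proof. exact: deco_mapE. Qed.

Lemma delta_natural x : delta W (Tr_map x) = Tr1_map (delta V x).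
Proof.
move: x; apply: (deco_ext (f := delta W \o Tr_map) (g := Tr1_map \o delta V)).
move=> n T v; transitivity (delta W (Tr_map (deco tree_act T v))) => //.
transitivity (Tr1_map (delta V (deco tree_act T v))) => //.
rewrite Tr_mapE !deltaE /delta_gen linear_sum.
by apply: eq_bigr => b _; rewrite linearZ Tr1_mapE.
Qed.

Lemma Tr_map_ker x : x \in kernel (delta V) -> Tr_map x \in kernel (delta W).
Proof.
move=> /eqP dx; apply/eqP; rewrite delta_natural dx; exact: linear0.
Qed.

Definition ker_delta_map (x : subspace (kernel (delta V))) :
    subspace (kernel (delta W)) :=
  Subspace (Tr_map_ker (valP x)).
End DeltaMap.
End Delta.
Arguments delta : simpl never.
Arguments Tr_map : simpl never.
Arguments Tr1_map : simpl never.

(* Main.v *)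
From HB Require Import structures.
Require Import Defs.
From mathcomp Require Import all_boot all_order all_fingroup all_algebra boolp zify.
From mathcomp Require Import generic_quotient.
From mathcomp.multinomials Require Import freeg.

(** The isomorphism goes through the tensor algebra.  Its product is
    associative, hence pre-Lie, so that the inclusion of V extends to a map
    [expand] from pL(V) to words.  A word v_1 ... v_n is then sent by [grow] to
    the sum of all increasing trees on v_1, ..., v_n, which is
    ((v_1 * v_2) * ...) * v_n in the pre-Lie algebra of trees.  The composite
    is restricted to L(V), which by the Jacobi identity is spanned by the
    left-normed brackets; bracketing with one more letter puts this letter at
    the right end of a word or, with the opposite sign, at its left end.

    Injectivity.  Sending a word of length n to 1/n times its left-normed
    bracket inverts [expand] on L(V) (Dynkin, Specht and Wever, [dynkin_expand]).
    The only increasing ladder is the word itself, so the coefficients on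
    ladders, that is on linear trees, undo [grow] ([ladder_word_grow]).

    L(V) is contained in the kernel.  The coefficient in delta (grow w) of a
    tree S with a special vertex o is the signed number of special edges e such
    that S / e is increasing.  Contracting the incoming edge from r puts r below
    all the other children of o; hence exactly one child qualifies, the
    earliest ([linext_sum]).  If o is not the root, this contribution cancels
    that of the outgoing edge; if o is the root, S is counted once when it is
    increasing above o ([delta_grow_word]).  Summing over the expansion of a
    left-normed bracket gives zero when o has two children or more: the last
    letter cancels if it is both a leaf and a child of o, and otherwise at most one
    of its two positions can occur and induction applies ([bracket_sum_linext_eq0]).

    The kernel is contained in L(V).  The coefficients c of an element of the
    kernel satisfy one relation for each tree S with a special vertex of arity
    at least 2.  Inserting o below a vertex p with several children writes c (U)
    as the sum of the c (U_r) where the child r of p has become the parent of the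
    others; iterating, c (U) is the sum of c over the ladders that are linear
    extensions of U ([blow_rel_linext]).  A root o carrying two ladders shows
    that c changes sign when the root of a tree made of two ladders with a
    common root moves to the next vertex ([blow_rel_tent]).  So for a word u of
    length n, n c (ladder u) is the alternating sum of the c on the n trees
    obtained by bending the ladder at each of its vertices.  A word is a linear
    extension of one of these exactly when u occurs in the expansion of its
    left-normed bracket, with the same sign ([bracket_coef_valley]).  As an element is
    recovered, up to n!, from its coefficients ([sum_tree_coef]), it is a Lie
    element; this divides by n and by n! ([kernel_lie_trees]). *)

Set Implicit Arguments.
Unset Strict Implicit.
Unset Printing Implicit Defensive.

Import GRing.Theory.
Local Open Scope ring_scope.

(** * Expansion of left-normed brackets into words *)

Section LeftNormedExpansion.
Variables (k : fieldType) (T : eqType).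

(** The left-normed bracket [[..[v_1, v_2], ..], v_n] is a signed sum of 2 ^ (n - 1)
    words in an associative algebra; [bracket_sum F r] is the sum with these signs of
    the values of F on these words.  The letters are listed in the order v_n, ..., v_1,
    for which the recursion on the last bracket is structural. *)
Fixpoint bracket_sum (M : lmodType k) (F : seq T -> M) (r : seq T) : M :=
  match r with
  | [::] => 0
  | z :: r' => if r' is [::] then F [:: z]
               else bracket_sum (fun u => F (rcons u z) - F (z :: u)) r'
  end.

Lemma bracket_sumS (M : lmodType k) (F : seq T -> M) z r : r != [::] ->
  bracket_sum F (z :: r) = bracket_sum (fun u => F (rcons u z) - F (z :: u)) r.
Proof. by case: r. Qed.

Lemma eq_bracket_sum (M : lmodType k) (F G : seq T -> M) r :
  (forall u, perm_eq u r -> F u = G u) -> bracket_sum F r = bracket_sum G r.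
Proof.
elim: r F G => //= z [|y r] IH F G FG; first exact: FG.
apply: IH => u ur; rewrite !FG //; first by rewrite perm_cons.
by rewrite perm_rcons perm_cons.
Qed.

(** Through this lemma [bracket_sum word] computes the image of a bracket under every
    linear map defined on words. *)
Lemma bracket_sum_linear (M N : lmodType k) (g : {linear M -> N}) (F : seq T -> M) r :
  g (bracket_sum F r) = bracket_sum (fun u => g (F u)) r.
Proof.
elim: r F => [|z r IH] F; first exact: linear0.
case: (eqVneq r [::]) => [-> //|r0]; rewrite !bracket_sumS // IH.
by apply: eq_bracket_sum => u _; rewrite linearB.
Qed.

Lemma bracket_sumD (M : lmodType k) (F G : seq T -> M) r :
  bracket_sum (fun u => F u + G u) r = bracket_sum F r + bracket_sum G r.
Proof.
elim: r F G => [|z r IH] F G; first by rewrite addr0.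
case: (eqVneq r [::]) => [-> //|r0]; rewrite !bracket_sumS // -IH.
by apply: eq_bracket_sum => u _; rewrite opprD addrACA.
Qed.

Lemma bracket_sumZ (M : lmodType k) (a : k) (F : seq T -> M) r :
  bracket_sum (fun u => a *: F u) r = a *: bracket_sum F r.
Proof. exact/esym/(bracket_sum_linear ( *:%R a : {linear M -> M})). Qed.

Lemma bracket_sumZl (M : lmodType k) (F : seq T -> k^o) (x : M) r :
  bracket_sum (fun u => F u *: x) r = bracket_sum F r *: x.
Proof.
elim: r F => [|z r IH] F; first by rewrite scale0r.
case: (eqVneq r [::]) => [-> //|r0]; rewrite !bracket_sumS // -IH.
by apply: eq_bracket_sum => u _; rewrite scalerBl.
Qed.

Lemma bracket_sum0 (M : lmodType k) r : bracket_sum (fun _ => 0 : M) r = 0.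
Proof.
rewrite -[RHS](scale0r (bracket_sum (fun _ => 0 : M) r)) -bracket_sumZ.
by apply: eq_bracket_sum => u _; rewrite scaler0.
Qed.

Lemma bracket_sumB (M : lmodType k) (F G : seq T -> M) r :
  bracket_sum (fun u => F u - G u) r = bracket_sum F r - bracket_sum G r.
Proof.
rewrite -scaleN1r -bracket_sumZ -bracket_sumD.
by apply: eq_bracket_sum => u _; rewrite scaleN1r.
Qed.

Lemma bracket_sum_sum (M : lmodType k) (I : Type) (s : seq I) (P : pred I)
    (F : I -> seq T -> M) r :
  bracket_sum (fun u => \sum_(i <- s | P i) F i u) r = \sum_(i <- s | P i) bracket_sum (F i) r.
Proof.
elim: s => [|i s IH].
  by rewrite big_nil -[RHS](bracket_sum0 M r); apply: eq_bracket_sum => u _; rewrite big_nil.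
rewrite big_cons -IH; case: ifP => Pi; last first.
  by apply: eq_bracket_sum => u _; rewrite big_cons Pi.
by rewrite -bracket_sumD; apply: eq_bracket_sum => u _; rewrite big_cons Pi.
Qed.

Definition bracket_coef (r u : seq T) : k :=
  bracket_sum (fun v => (v == u)%:R : k^o) r.

Lemma bracket_sum_bracket_coef (M : lmodType k) (F : seq T -> M) r : uniq r ->
  bracket_sum F r = \sum_(u <- permutations r) bracket_coef r u *: F u.
Proof.
move=> ur; transitivity (bracket_sum (fun v => \sum_(u <- permutations r) (v == u)%:R *: F u) r).
  apply: eq_bracket_sum => v vr; rewrite (bigD1_seq v) ?permutations_uniq ?mem_permutations //=.
  rewrite eqxx scale1r big1 ?addr0 // => u uv.
  by rewrite eq_sym (negPf uv) scale0r.
rewrite bracket_sum_sum; apply: eq_bigr => u _.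
by rewrite bracket_sumZl.
Qed.

End LeftNormedExpansion.

Lemma bracket_sum_map (k : fieldType) (T T' : eqType) (M : lmodType k) (F : seq T' -> M)
    (f : T -> T') r : bracket_sum F (map f r) = bracket_sum (fun u => F (map f u)) r.
Proof.
elim: r F => // z r IH F; have [->//|r0] := eqVneq r [::].
rewrite map_cons !bracket_sumS //; last by rewrite -size_eq0 size_map size_eq0.
by rewrite IH; apply: eq_bracket_sum => u _; rewrite map_rcons.
Qed.

(** * Linear extensions *)

Section LinearExtension.
Variables (k : fieldType) (T : eqType).
Implicit Types (p : T -> option T) (u r : seq T).

(** The linear extensions of the forest with parent function p, the roots being read first. *)
Definition linext p u : bool :=
  all (fun x => if p x is Some y then (index y u < index x u)%N else true) u.

Lemma linextP p u :
  reflect (forall x y, x \in u -> p x = Some y -> (index y u < index x u)%N)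
          (linext p u).
Proof.
apply: (iffP allP) => [H x y xu pxy|H x xu]; first by have := H x xu; rewrite pxy.
by case pxy: (p x) => [y|] //; apply: H.
Qed.

Lemma linext_rcons p u z : z \notin u ->
  (forall x y, x \in rcons u z -> p x = Some y -> y \in rcons u z) ->
  linext p (rcons u z) = ~~ has (fun x => p x == Some z) (rcons u z) && linext p u.
Proof.
move=> zu pu; apply/linextP/andP => [H|[/hasPn nz /linextP H] x y].
  split.
    apply/hasPn => x xu; apply/eqP => /H -/(_ xu).
    have := xu; rewrite -index_mem size_rcons.
    by rewrite -[X in index z X]cats1 index_cat (negPf zu) /= eqxx addn0; lia.
  apply/linextP => x y xu pxy; have xuz : x \in rcons u z by rewrite mem_rcons in_cons xu orbT.
  have := H _ _ xuz pxy; rewrite -cats1 !index_cat xu.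
  by case: ifP => //= yu; have := index_size x u; lia.
rewrite mem_rcons in_cons => xzu pxy.
have xuz : x \in rcons u z by rewrite mem_rcons.
have yu : y \in u.
  have := pu _ _ xuz pxy; rewrite mem_rcons in_cons => /orP[/eqP yz|//].
  by have := nz _ xuz; rewrite pxy yz eqxx.
rewrite -cats1 !index_cat yu; case: ifP => [xu|_]; first exact: H.
by have := yu; rewrite -index_mem; lia.
Qed.

(** The parent function left by a root z once it has been read: its children become roots. *)
Definition uproot p z x := if p x == Some z then None else p x.

Lemma linext_cons p u z : z \notin u ->
  linext p (z :: u) = (p z == None) && linext (uproot p z) u.
Proof.
move=> zu; apply/linextP/andP => [H|[/eqP pz /linextP H] x y].
  split; first by case pz: (p z) => [y|] //; have := H z y (mem_head _ _) pz; rewrite /= eqxx.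
  apply/linextP => x y xu; rewrite /uproot; case: eqP => // pxz pxy.
  have xzu : x \in z :: u by rewrite in_cons xu orbT.
  have := H _ _ xzu pxy => /=; case: (eqVneq z x) => [zx|_]; first by rewrite zx xu in zu.
  by case: (eqVneq z y) => // zy; case: pxz; rewrite pxy zy.
rewrite in_cons => /orP[/eqP ->|xu pxy]; first by rewrite pz.
rewrite /=; case: (eqVneq z x) => [zx|_]; first by rewrite zx xu in zu.
case: (eqVneq z y) => // zy; apply: (H x y) => //; rewrite /uproot pxy.
by case: eqP => // -[] yz; rewrite yz eqxx in zy.
Qed.

Lemma count_uproot p z r :
  count (fun x => uproot p z x == None) r =
  (count (fun x => p x == None) r + count (fun x => p x == Some z) r)%N.
Proof.
elim: r => //= x r ->; rewrite /uproot.
by case: (eqVneq (p x) (Some z)) => [->|]; rewrite /= ?add0n; lia.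
Qed.

(** A functional that counts the linear extensions of a forest with at least two trees
    vanishes on brackets, because it vanishes on shuffles of nonempty words.  The letter z
    added last can only be read last if it is a leaf, and first if it is a root.  If it is
    both, the two positions cancel; if it is only one of them, what remains is again a
    forest with at least two trees. *)
Lemma bracket_sum_linext_eq0 p r : uniq r ->
  (forall x y, x \in r -> p x = Some y -> y \in r) ->
  (1 < count (fun x => p x == None) r)%N ->
  bracket_sum (fun u => (linext p u)%:R : k^o) r = 0.
Proof.
elim: r p => [//|z r IH] p; rewrite cons_uniq => /andP[zr ur] pr two; rewrite /= in two.
have r0 : r != [::] by apply: contraTneq two => -> /=; case: eqP.
rewrite bracket_sumS //.
pose leaf := ~~ has (fun x => p x == Some z) (z :: r).
transitivity (bracket_sum (fun u => (leaf && linext p u)%:R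
                   - ((p z == None) && linext (uproot p z) u)%:R : k^o) r).
  apply: eq_bracket_sum => u uur; have zu : z \notin u by rewrite (perm_mem uur).
  have zur : perm_eq (rcons u z) (z :: r) by rewrite perm_rcons perm_cons.
  rewrite linext_cons // linext_rcons //; last first.
    by move=> x y; rewrite !(perm_mem zur); apply: pr.
  by rewrite (eq_has_r (perm_mem zur)).
rewrite bracket_sumB.
have E (b : bool) q : bracket_sum (fun u => (b && linext q u)%:R : k^o) r
    = if b then bracket_sum (fun u => (linext q u)%:R : k^o) r else 0.
  by case: b => //=; apply: bracket_sum0.
rewrite !E {E}; case: (boolP leaf) => [lf|nlf]; case: (eqVneq (p z) None) => pz.
- apply/eqP; rewrite subr_eq0; apply/eqP/eq_bracket_sum => u uur; congr (_%:R).
  congr nat_of_bool; apply: eq_in_all => x; rewrite (perm_mem uur) => xr.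
  move: lf; rewrite /leaf -all_predC => /allP/(_ x); rewrite in_cons xr orbT => /(_ isT) /=.
  by rewrite /uproot => /negPf ->.
- rewrite subr0; apply: IH => //; last by move: two; rewrite (negPf pz).
  move=> x y xr pxy; have := pr x y; rewrite !in_cons xr orbT => /(_ isT pxy).
  case/orP=> // /eqP yz; move: lf; rewrite /leaf -all_predC => /allP/(_ x).
  by rewrite in_cons xr orbT => /(_ isT) /=; rewrite pxy yz eqxx.
- rewrite sub0r; apply/eqP; rewrite oppr_eq0; apply/eqP; apply: IH => //.
    move=> x y xr; rewrite /uproot; case: eqP => // pxz pxy.
    have := pr x y; rewrite !in_cons xr orbT => /(_ isT pxy).
    by case/orP=> // /eqP yz; case: pxz; rewrite pxy yz.
  rewrite count_uproot; move: two nlf; rewrite /leaf negbK /= pz /= add1n ltnS.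
  rewrite has_count; lia.
- by rewrite subr0.
Qed.

End LinearExtension.

Section Valley.
Variables (k : fieldType).

Definition peaked i (m : seq nat) : bool :=
  all (fun j => if (j < i)%N then (nth 0%N m j < nth 0%N m j.+1)%N
                else (nth 0%N m j.+1 < nth 0%N m j)%N) (iota 0 (size m).-1).

Lemma peakedP i m :
  reflect (forall j, (j.+1 < size m)%N ->
    if (j < i)%N then (nth 0%N m j < nth 0%N m j.+1)%N
    else (nth 0%N m j.+1 < nth 0%N m j)%N) (peaked i m).
Proof.
apply: (iffP allP) => H j.
  by move=> jm; have := H j; rewrite mem_iota; case: ifP => _; apply; lia.
by rewrite mem_iota => jm; have := H j; case: ifP => _; apply; lia.
Qed.

Lemma peaked_map_succ i m : peaked i (map succn m) = peaked i m.
Proof.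
apply/peakedP/peakedP; rewrite size_map => H j jm; have := H j jm;
  by rewrite !(nth_map 0%N) //; lia.
Qed.

Lemma peaked_rcons i m : (i < size m)%N -> {in m, forall a, 0 < a}%N ->
  peaked i (rcons m 0%N) = peaked i m.
Proof.
move=> im m0; apply/peakedP/peakedP; rewrite size_rcons => H j jm.
  by have := H j (ltnW jm); rewrite !nth_rcons jm (ltnW jm).
rewrite !nth_rcons; have [jm'|jm'] := ltnP j.+1 (size m).
  by rewrite (ltnW jm'); exact: (H j).
have Ej : j.+1 = size m by apply/anti_leq; rewrite jm' andbT.
rewrite Ej eqxx leqnn leqNgt im /=.
by apply: m0; apply: mem_nth; rewrite -Ej.
Qed.

Lemma peaked_cons i m : {in m, forall a, 0 < a}%N ->
  peaked i.+1 (0%N :: m) = peaked i m.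
Proof.
move=> m0; apply/peakedP/peakedP => H j jm; first by have := H j.+1 jm.
case: j jm => [|j] jm /=; last exact: H.
by apply: m0; apply: mem_nth.
Qed.

Variable T : eqType.
Implicit Types (u r : seq T).

Definition valley_sum r u : k :=
  \sum_(i < size u) (-1) ^+ i * (peaked i [seq index x r | x <- u])%:R.

Lemma index_cons_map (r u : seq T) z : z \notin u ->
  [seq index x (z :: r) | x <- u] = map succn [seq index x r | x <- u].
Proof.
move=> zu; rewrite -map_comp; apply/eq_in_map => x xu /=.
by case: eqP => // zx; rewrite zx xu in zu.
Qed.

(** In the expansion of [[..[v_1, v_2], ..], v_n] the letters before v_1 are those that were
    put at the left, so they occur in decreasing order, and those after v_1 in increasing
    order.  The sign counts the former, hence is given by the position of v_1.  Since r
    lists the letters backwards, the indices in r have a peak there. *)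
Lemma bracket_coef_valley r u : uniq r -> perm_eq u r -> r != [::] ->
  bracket_coef k r u = valley_sum r u.
Proof.
elim: r u => [//|z r IH] u; rewrite cons_uniq => /andP[zr ur] uzr _; rewrite /bracket_coef.
have [r0|r0] := eqVneq r [::].
  move: uzr; rewrite r0 => uz; have -> : u = [:: z].
    by apply: perm_small_eq uz.
  by rewrite /= /valley_sum big_ord_recl big_ord0 eqxx expr0 mul1r addr0.
rewrite bracket_sumS //.
have uu : uniq u by rewrite (perm_uniq uzr) /= zr.
have zu : z \in u by rewrite (perm_mem uzr) mem_head.
have su : size u = (size r).+1 by rewrite (perm_size uzr).
have r1 : (0 < size r)%N by case: (r) r0.
have [b [v Eu]] : exists b v, u = b ++ z :: v.
  by case/splitPr: zu => b v; exists b, v.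
have zv : z \notin b ++ v.
  by move: uu; rewrite Eu uniq_catC cons_uniq mem_cat => /andP[]; rewrite mem_cat orbC.
have bvr : perm_eq (b ++ v) r.
  by have := uzr; rewrite Eu -cat1s perm_catCA perm_cons.
have sbv : size (b ++ v) = size r by rewrite (perm_size bvr).
have [v0|v0] := eqVneq v [::].
  rewrite v0 cats0 in Eu zv bvr sbv * => {v0 v}.
  rewrite Eu cats1; transitivity (bracket_sum (fun w => (w == b)%:R : k^o) r).
    refine (@eq_bracket_sum k T k^o _ _ r _) => w wr; rewrite eqseq_rcons eqxx andbT.
    suff /negPf-> : z :: w != rcons b z by rewrite subr0.
    case: (b) zv sbv => [|c b'] /=; first by move=> _ e; rewrite -e in r1.
    by rewrite in_cons negb_or => /andP[/negPf zc _] _; rewrite eqseq_cons zc.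
  have Em : [seq index x (z :: r) | x <- rcons b z]
            = rcons (map succn [seq index x r | x <- b]) 0%N.
    by rewrite map_rcons index_cons_map //= eqxx.
  rewrite -/(bracket_coef k r b) IH // /valley_sum size_rcons big_ord_recr Em /=.
  (* There is no peak at a last letter whose index is the smallest. *)
  rewrite [X in _ + _ * X](_ : _ = 0); last first.
    case: peakedP => //= /(_ (size b).-1); rewrite size_rcons !size_map.
    by rewrite !nth_rcons !size_map prednK ?sbv // ltnn eqxx leqnn => /(_ isT); rewrite ?leqnn ltn0.
  rewrite mulr0 addr0; apply: eq_bigr => i _.
  rewrite peaked_rcons ?size_map ?peaked_map_succ //.
  by move=> _ /mapP[a _ ->].
have [b0|b0] := eqVneq b [::].
  rewrite b0 cat0s in Eu zv bvr sbv * => {b0 b}.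
  rewrite Eu; transitivity (- bracket_sum (fun w => (w == v)%:R : k^o) r).
    rewrite -scaleN1r -bracket_sumZ; refine (@eq_bracket_sum k T k^o _ _ r _) => w wr.
    rewrite eqseq_cons eqxx andTb.
    suff /negPf-> : rcons w z != z :: v by rewrite scaleN1r sub0r.
    case: (w) (perm_mem wr z) (perm_size wr) => [|c w'] /=.
      by move=> _ e; rewrite -e in r1.
    rewrite (negPf zr) in_cons => /negbT; rewrite negb_or => /andP[/negPf zc _] _.
    by rewrite eqseq_cons eq_sym zc.
  have Em : [seq index x (z :: r) | x <- z :: v]
            = 0%N :: map succn [seq index x r | x <- v].
    by rewrite map_cons index_cons_map //= eqxx.
  rewrite -/(bracket_coef k r v) IH // /valley_sum Em /= big_ord_recl.
  (* There is no peak at a first letter whose index is the smallest. *)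
  rewrite [X in _ * X](_ : _ = 0); last first.
    by case: peakedP => //= /(_ 0%N); rewrite !size_map ltnS sbv r1 => /(_ isT).
  rewrite mulr0 add0r -sumrN; apply: eq_bigr => i _ /=.
  rewrite peaked_cons ?peaked_map_succ; last by move=> _ /mapP[a _ ->].
  by rewrite /bump /= add1n exprS mulN1r mulNr.
rewrite [RHS]big1 => [|i _].
  rewrite -[RHS](bracket_sum0 k^o r); refine (@eq_bracket_sum k T k^o _ _ r _) => w wr.
  have zw : z \notin w by rewrite (perm_mem wr).
  suff [/negPf-> /negPf->] : rcons w z != u /\ z :: w != u by rewrite subr0.
  rewrite Eu; split; apply/eqP; last first.
    case: (b) b0 zv => //= c b' _; rewrite in_cons negb_or => /andP[/eqP zc _].
    by case.
  case/lastP: (v) v0 zv => // v' c _; rewrite -rcons_cat mem_rcons in_cons negb_or.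
  by case/andP=> /eqP zc _; rewrite -rcons_cons -rcons_cat => /rcons_inj[].
case: peakedP => H; last by rewrite mulr0.
move: (nat_of_ord i) H => {}i; rewrite size_map su => H.
have sb : (0 < size b)%N by case: (b) b0.
have sv : (0 < size v)%N by case: (v) v0.
rewrite size_cat in sbv.
have zi : nth 0%N [seq index x (z :: r) | x <- u] (size b) = 0%N.
  by rewrite (nth_map z) ?su; [rewrite Eu nth_cat ltnn subnn /= eqxx | lia].
have [bi|ib] := ltnP (size b) i.
  have lt_i : ((size b).-1 < i)%N by rewrite prednK // ltnW.
  have := H (size b).-1; rewrite lt_i prednK // zi ltn0 -sbv ltnS leq_addr.
  by move/(_ isT).
have lt_i : (size b < i)%N = false by rewrite ltnNge ib.
have := H (size b); rewrite lt_i zi ltn0 -sbv ltnS -addn1 leq_add2l sv.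
by move/(_ isT).
Qed.

End Valley.

(** * Rooted trees *)

Section RootedTrees.
Variable T : finType.

Lemma is_rtree_measure (p : {ffun T -> option T}) r (d : T -> nat) :
  p r = None -> (forall x, x != r -> exists2 y, p x = Some y & (d y < d x)%N) ->
  is_rtree p.
Proof.
move=> pr pd; apply/existsP; exists r; rewrite pr eqxx; apply/forallP => x.
have [m] := ubnP (d x); elim: m x => // m IH x dx.
have [->|/pd[y px dy]] := eqVneq x r; first exact: connect0.
apply: connect_trans (connect1 _) (IH y _); first by rewrite px.
by apply: leq_trans dy _; rewrite -ltnS.
Qed.

Lemma rtree_root (t : rtree T) :
  exists2 r, parent t r = None & forall x, parent t x = None -> x = r.
Proof.
have /existsP[r /andP[/eqP tr /forallP ctr]] := valP t.
exists r => // x tx; have /connectP[[|y q] //= /andP[/eqP + _] _] := ctr x.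
by rewrite -/(parent t x) tx.
Qed.

(** The depth of a vertex is the number of steps after which iterating the parent function
    fails. *)
Lemma rtree_depth (t : rtree T) :
  exists d : T -> nat, forall x y, parent t x = Some y -> (d y < d x)%N.
Proof.
pose up m x := iter m (obind (parent t)) (Some x).
have ex x : exists m, up m x == None.
  have /existsP[r /andP[/eqP tr /forallP/(_ x)/connectP[q pq lq]]] := valP t.
  exists (size q).+1; rewrite /up /=.
  suff -> : iter (size q) (obind (parent t)) (Some x) = Some r.
    by rewrite /= /parent tr.
  elim: q x pq lq => [|y q IH] x /=; first by move=> _ ->.
  by move=> /andP[/eqP xy pq] lq; rewrite -iterS iterSr /= /parent xy; apply: IH.
exists (fun x => ex_minn (ex x)) => x y xy.
case: (ex_minnP (ex x)) => -[//|m] um _; case: ex_minnP => m' _ /(_ m); apply.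
by move: um; rewrite /up iterSr /= xy.
Qed.

(** Sorting the vertices by depth gives a linear extension. *)
Lemma rtree_linext (t : rtree T) :
  exists2 w, perm_eq w (enum T) & linext (parent t) w.
Proof.
have [d td] := rtree_depth t; pose le x y := (d x <= d y)%N.
have letr : transitive le by move=> y x z; apply: leq_trans.
exists (sort le (enum T)); first by rewrite perm_sort.
apply/linextP => x y _ xy; rewrite ltnNge; apply/negP => lexy.
have S : sorted le (sort le (enum T)) by apply: sort_sorted => a b; apply: leq_total.
have mw z : z \in sort le (enum T) by rewrite mem_sort mem_enum.
have := sorted_leq_index letr (fun z => leqnn (d z)) S x y (mw x) (mw y) lexy.
by rewrite /le leqNgt (td _ _ xy).
Qed.

Definition mk_rtree (p : {ffun T -> option T}) (pP : is_rtree p) : rtree T :=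
  exist _ p pP.

Lemma big_option (M : nmodType) (F : option T -> M) :
  \sum_a F a = F None + \sum_x F (Some x).
Proof.
rewrite (bigD1 None) //=; congr (_ + _).
rewrite (reindex_omap Some id) => [|[x|] //].
by apply: eq_bigl => x; rewrite eqxx.
Qed.

End RootedTrees.

(** * Coefficient functions annihilated by the blow-up relations *)

Section Relations.
Variables (k : fieldType) (n : nat) (M : lmodType k).
Implicit Types (c : {ffun 'I_n -> option 'I_n} -> M) (u w : seq 'I_n) (U : Tree n).

Local Notation orders := (permutations (enum 'I_n)).

(** The relations that delta (x) = 0 imposes on the coefficients c of x.  They are stated for
    functions on all parent functions because [contract] is one. *)
Definition blow_rel c := forall S : Tree1 n, (1 < arity S None)%N ->
  \sum_(e in edges S | special e)
     (if e.2 == None then 1 else -1 : k) *: c (contract S e) = 0.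

Lemma special_sum c (S : Tree1 n) :
  \sum_(e in edges S | special e)
     (if e.2 == None then 1 else -1 : k) *: c (contract S e)
  = \sum_(x | parent S (Some x) == Some None) c (contract S (Some x, None))
    - \sum_(y | parent S None == Some (Some y)) c (contract S (None, Some y)).
Proof.
pose G a b := if ((a, b) \in edges S) && special (a, b)
  then (if b == None then 1 else -1 : k) *: c (contract S (a, b)) else 0.
transitivity (\sum_a \sum_b G a b).
  by rewrite pair_big big_mkcond; apply: eq_bigr => -[].
rewrite /G {G} !big_option.
rewrite inE /= (negPf (parent_neq S None)) add0r addrC; congr (_ + _).
  rewrite [RHS]big_mkcond /=; apply: eq_bigr => x _; rewrite big_option.
  rewrite [X in _ + X]big1 => [|y _]; last by rewrite andbF.
  by rewrite addr0 inE /= andbT scale1r.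
rewrite [in RHS]big_mkcond -sumrN; apply: eq_bigr => y _.
by rewrite inE /= andbT; case: ifP => _; rewrite ?oppr0 ?scaleN1r.
Qed.

Definition children (S : Tree1 n) : {set 'I_n} :=
  [set x | parent S (Some x) == Some None].

Lemma arity_special (S : Tree1 n) : arity S None = #|children S|.
Proof.
rewrite /arity -[RHS](card_imset _ (@Some_inj _)); apply: eq_card => -[x|].
  rewrite inE; apply/idP/imsetP => [Sx|[y + [->]]]; last by rewrite inE.
  by exists x; rewrite // inE.
rewrite inE (negPf (parent_neq S None)); apply/esym/negP => /imsetP[]; by [].
Qed.

(** The tree obtained by removing the special vertex and attaching its children to its
    parent, or the forest that is left if it is the root.  Contracting a special edge of S
    modifies it at most at the children of the special vertex. *)
Definition detach (S : Tree1 n) : {ffun 'I_n -> option 'I_n} :=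
  [ffun x => obind (fun a => if a is Some _ then a else obind id (parent S None))
               (parent S (Some x))].

(** The vertices in K, which have the same parent, are moved below the one of them, r, that
    is to be read first. *)
Definition choose_first (p : {ffun 'I_n -> option 'I_n}) (K : {set 'I_n}) r :
    {ffun 'I_n -> option 'I_n} :=
  [ffun x => if x == r then p r else if x \in K then Some r else p x].

Lemma contract_out S y : parent S None = Some (Some y) ->
  contract S (None, Some y) = detach S.
Proof. by move=> Sy; apply/ffunP => x; rewrite !ffunE /= Sy. Qed.

Lemma contract_in S r : r \in children S ->
  contract S (Some r, None) = choose_first (detach S) (children S) r.
Proof.
rewrite inE => /eqP Sr; apply/ffunP => x.
rewrite !ffunE /= [Some x == _](inj_eq (@Some_inj _)); have [xr|xr] := eqVneq x r.
  rewrite Sr /=; case SN: (parent S None) => [[y|]|] //=.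
  by move: (parent_neq S None); rewrite SN eqxx.
by rewrite inE; case: (parent S (Some x)) => [[y|]|].
Qed.

Lemma linext_choose (p : {ffun 'I_n -> option 'I_n}) (K : {set 'I_n}) r w :
  w \in orders -> r \in K -> {in K, forall x, p x = p r} ->
  linext (choose_first p K r) w =
  linext p w && [forall x in K, (index r w <= index x w)%N].
Proof.
rewrite mem_permutations => /perm_mem wE rK pK.
have mw x : x \in w by rewrite wE mem_enum.
apply/linextP/andP => [H|[/linextP H /forall_inP Hm] x y _].
  have Hr x : x \in K -> x != r -> (index r w < index x w)%N.
    by move=> xK xr; apply: H => //; rewrite ffunE (negPf xr) xK.
  split; last first.
    apply/forall_inP => x xK.
    by have [->//|xr] := eqVneq x r; apply/ltnW/Hr.
  apply/linextP => x y _ px; have [xr|xr] := eqVneq x r.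
    by apply: H; rewrite // xr ffunE eqxx -xr.
  have [xK|xK] := boolP (x \in K); last first.
    by apply: H => //; rewrite ffunE (negPf xr) (negPf xK).
  apply: ltn_trans (Hr x xK xr); apply: H => //.
  by rewrite ffunE eqxx -(pK x xK).
rewrite ffunE; have [->|xr] := eqVneq x r; first by apply: H.
case: ifP => [xK [<-]|_ pxy]; last exact: H.
rewrite ltn_neqAle Hm // andbT.
by apply: contra xr => /eqP E; rewrite -(nth_index r (mw x)) -E nth_index.
Qed.

(** In a linear extension, exactly one of the vertices in K comes first. *)
Lemma linext_sum (N : nmodType) (F : seq 'I_n -> N)
    (p : {ffun 'I_n -> option 'I_n}) (K : {set 'I_n}) :
  (0 < #|K|)%N -> {in K &, forall x y, p x = p y} ->
  \sum_(w <- orders | linext p w) F w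
  = \sum_(r in K) \sum_(w <- orders | linext (choose_first p K r) w) F w.
Proof.
case/card_gt0P=> x0 x0K pK; rewrite big_mkcond.
under [RHS]eq_bigr => r _ do rewrite big_mkcond.
rewrite exchange_big /=; apply: eq_big_seq => w ww.
have E r : r \in K -> {in K, forall x, p x = p r} by move=> rK x xK; apply: pK.
case: (@arg_minnP _ x0 (mem K) (fun x => index x w)) => // r rK rmin.
rewrite (bigD1 r) //= (linext_choose ww rK (E r rK)).
rewrite [X in _ && X](_ : _ = true) ?andbT; last by apply/forall_inP.
rewrite big1 ?addr0 // => x /andP[xK xr]; rewrite (linext_choose ww xK (E x xK)).
case: ifP => // /andP[_ /forall_inP/(_ r rK) lexr].
have mw y : y \in w.
  by move: ww; rewrite mem_permutations => /perm_mem ->; rewrite mem_enum.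
have Exr : index x w = index r w by apply/anti_leq; rewrite lexr; apply: rmin.
by case/eqP: xr; rewrite -(nth_index r (mw x)) Exr nth_index.
Qed.

Lemma detach_children S : {in children S &, forall x y, detach S x = detach S y}.
Proof.
move=> x y; rewrite 2!inE => /eqP Sx /eqP Sy.
by rewrite !ffunE Sx Sy.
Qed.

(** The special vertex is put between p and all the children of p. *)
Definition insert_special U p : {ffun option 'I_n -> option (option 'I_n)} :=
  [ffun a => if a is Some x
             then if parent U x == Some p then Some None else omap Some (parent U x)
             else Some (Some p)].

Lemma is_rtree_insert U p : is_rtree (insert_special U p).
Proof.
have [r Ur rU] := rtree_root U; have [d Ud] := rtree_depth U.
(* Doubling the depths leaves room for the special vertex just above p. *)
pose d' a := if a is Some x then (d x).*2 else (d p).*2.+1.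
apply: (@is_rtree_measure _ _ (Some r) d') => [|[x|] xr].
- by rewrite ffunE Ur.
- rewrite ffunE; case Ux: (parent U x) => [y|]; last first.
    by move: xr; rewrite (rU x Ux) eqxx.
  case: eqP => [[yp]|_]; [exists None|exists (Some y)] => //=;
    by have := Ud _ _ Ux; rewrite ?yp; lia.
- by rewrite ffunE; exists (Some p) => //=; lia.
Qed.

Definition insert_tree U p : Tree1 n := mk_rtree (is_rtree_insert U p).

Lemma insert_treeE U p a : parent (insert_tree U p) a =
  if a is Some x then if parent U x == Some p then Some None else omap Some (parent U x)
  else Some (Some p).
Proof. exact: ffunE. Qed.

Lemma children_insert U p :
  children (insert_tree U p) = [set x | parent U x == Some p].
Proof.
apply/setP => x; rewrite !inE insert_treeE.
by case: ifP => //= _; case: (parent U x).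
Qed.

Lemma detach_insert U p : detach (insert_tree U p) = val U.
Proof.
apply/ffunP => x; rewrite ffunE !insert_treeE -/(parent U x).
by case: eqP => [->|] //=; case: (parent U x).
Qed.

Lemma is_rtree_choose U p r : parent U r = Some p ->
  is_rtree (choose_first (val U) [set x | parent U x == Some p] r).
Proof.
move=> Ur; have rS : r \in children (insert_tree U p) by rewrite children_insert inE Ur.
rewrite -{1}(detach_insert U p) -children_insert -contract_in //.
by apply: is_rtree_contract; rewrite // inE; move: rS; rewrite inE.
Qed.

(** The relation of the tree with the special vertex inserted between p and its children:
    contracting the outgoing edge gives U back. *)
Lemma blow_rel_choose c U p : blow_rel c ->
  (1 < #|[set x | parent U x == Some p]|)%N ->
  c (val U) = \sum_(r in [set x | parent U x == Some p])
                 c (choose_first (val U) [set x | parent U x == Some p] r).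
Proof.
rewrite -children_insert -(detach_insert U p); set S := insert_tree U p => rel two.
have := rel S; rewrite arity_special => /(_ two); rewrite special_sum => /eqP.
have Sp : parent S None = Some (Some p) by rewrite insert_treeE.
rewrite subr_eq0 => /eqP; rewrite [X in _ = X](big_pred1 p); last first.
  by move=> y; rewrite Sp; apply/eqP/eqP => [[->]|->].
rewrite contract_out // => <-; rewrite /children; apply: eq_big => [x|x xS].
  by rewrite inE.
by rewrite contract_in // inE.
Qed.

(** The ladder u bent at its vertex of index i, which becomes the root: the earlier vertices
    form one branch, in reverse order, and the later ones the other. *)
Definition tent i u : {ffun 'I_n -> option 'I_n} :=
  [ffun x => let j := index x u in
     if j == i then None
     else Some (nth x u (if (j < i)%N then j.+1 else j.-1))].

Definition ladder u := tent 0 u.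

(** Reversing w turns the condition that parents come first into the one of
    [bracket_coef_valley]. *)
Lemma linext_tent i u w : (i < n)%N -> u \in orders -> w \in orders ->
  linext (tent i u) w = peaked i [seq index x (rev w) | x <- u].
Proof.
rewrite !mem_permutations => lt_in uE wE.
have su : size u = n by rewrite (perm_size uE) size_enum_ord.
have mu x : x \in u by rewrite (perm_mem uE) mem_enum.
have mw x : x \in w by rewrite (perm_mem wE) mem_enum.
have uu : uniq u by rewrite (perm_uniq uE) enum_uniq.
have uw : uniq w by rewrite (perm_uniq wE) enum_uniq.
have iw x y : (index y w < index x w)%N = (index x (rev w) < index y (rev w))%N.
  have arith a b : (a < b)%N -> (b - (b.-1 - a).+1 = a)%N /\ (b.-1 - a < b)%N by lia.
  have E z : index z (rev w) = ((size w).-1 - index z w)%N.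
    have iz : (index z w < size w)%N by rewrite index_mem.
    have [e1 e2] := arith _ _ iz.
    have {1}-> : z = nth z (rev w) ((size w).-1 - index z w).
      by rewrite nth_rev // e1 nth_index.
    by rewrite index_uniq ?rev_uniq ?size_rev.
  have arith2 a b m : (a < m)%N -> (b < m)%N -> (a < b)%N = (m.-1 - b < m.-1 - a)%N by lia.
  by rewrite !E; apply: arith2; rewrite index_mem.
apply/linextP/peakedP => [H j|H x y _].
  rewrite size_map => ju; have x0 : 'I_n by case: (u) ju.
  rewrite !(nth_map x0) ?(ltnW ju) //.
  case: ifP => ji; rewrite -iw; apply: H => //; rewrite ffunE index_uniq ?(ltnW ju) //=.
    by rewrite ltn_eqF // ji; congr Some; apply: set_nth_default.
  have ij : (i <= j)%N by rewrite leqNgt ji.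
  rewrite gtn_eqF ?ltnS // ltnNge (leqW ij) /=.
  by congr Some; apply: set_nth_default; apply: ltnW.
have xu : (index x u < size u)%N by rewrite index_mem.
rewrite ffunE /= iw; case: eqP => // ji [<-]; case: (ltnP (index x u) i) => ji'.
  have ju : ((index x u).+1 < size u)%N by rewrite su (leq_ltn_trans ji').
  have := H (index x u); rewrite size_map ji' ju => /(_ isT).
  by rewrite !(nth_map x) // nth_index.
have {ji ji'}ji : (i < index x u)%N by rewrite ltn_neqAle ji' andbT eq_sym; apply/eqP.
case j: (index x u) ji xu => [//|m] mi mu'.
have := H m; rewrite size_map mu' ltnNge -ltnS mi /= => /(_ isT).
by rewrite !(nth_map x) ?(ltnW mu') // -j nth_index.
Qed.

(** The special vertex is the root, between the vertices of index i and i.+1 of the ladder u: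
    contracting either of its two edges bends u at i or at i.+1. *)
Definition two_ladders i u : {ffun option 'I_n -> option (option 'I_n)} :=
  [ffun a => if a is Some x then
     let j := index x u in
     if (j == i) || (j == i.+1) then Some None
     else Some (Some (nth x u (if (j < i)%N then j.+1 else j.-1)))
   else None].

Lemma is_rtree_two_ladders i u : (i.+1 < n)%N -> u \in orders ->
  is_rtree (two_ladders i u).
Proof.
rewrite mem_permutations => lt_in uE.
have su : size u = n by rewrite (perm_size uE) size_enum_ord.
have mu x : (index x u < size u)%N by rewrite index_mem (perm_mem uE) mem_enum.
have uu : uniq u by rewrite (perm_uniq uE) enum_uniq.
(* The distance to the special vertex, which lies between i and i.+1. *)
pose e j := if (j <= i)%N then (i - j).+1 else (j - i)%N.
have e1 j : (j < i)%N -> (e j.+1 < e j)%N by rewrite /e; do 2!case: ifP => ?; lia.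
have e2 j : (i <= j)%N -> j != i -> j != i.+1 -> (e j.-1 < e j)%N.
  by rewrite /e; do 2!case: ifP => ?; lia.
pose d a := if a is Some x then e (index x u) else 0%N.
apply: (@is_rtree_measure _ _ None d) => [|[x|] // _]; first by rewrite ffunE.
rewrite ffunE /=; case: ifP => [ji|/norP[ji ji']].
  by exists None => //=; rewrite /e; case: ifP => //; lia.
have := mu x; rewrite su => xu; case: ltnP => ij.
  exists (Some (nth x u (index x u).+1)) => //=.
  rewrite index_uniq ?su //; last exact: leq_ltn_trans ij (ltnW lt_in).
  exact: e1.
exists (Some (nth x u (index x u).-1)) => //=.
rewrite index_uniq ?su //; last exact: leq_ltn_trans (leq_pred _) xu.
exact: e2.
Qed.

Lemma is_rtree_tent i u : (i < n)%N -> u \in orders -> is_rtree (tent i u).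
Proof.
rewrite mem_permutations => lt_in uE.
have su : size u = n by rewrite (perm_size uE) size_enum_ord.
have mu x : (index x u < size u)%N by rewrite index_mem (perm_mem uE) mem_enum.
have uu : uniq u by rewrite (perm_uniq uE) enum_uniq.
have iu : (i < size u)%N by rewrite su.
pose e j := if (j <= i)%N then (i - j)%N else (j - i)%N.
have e1 j : (j < i)%N -> (e j.+1 < e j)%N by rewrite /e; do 2!case: ifP => ?; lia.
have e2 j : (i <= j)%N -> j != i -> (e j.-1 < e j)%N.
  by rewrite /e; do 2!case: ifP => ?; lia.
pose d x := e (index x u).
have x0 : 'I_n := Ordinal lt_in.
pose r := nth x0 u i.
apply: (@is_rtree_measure _ _ r d) => [|x xr].
  by rewrite ffunE /= index_uniq // eqxx.
have ji : index x u != i.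
  apply: contra xr => /eqP ji; rewrite /r -ji nth_index //.
  by rewrite -index_mem.
have := mu x; rewrite su => xu; rewrite ffunE /= (negPf ji).
case: ltnP => ij.
  exists (nth x u (index x u).+1) => //=.
  rewrite /d /= index_uniq ?su //; last exact: leq_ltn_trans ij lt_in.
  exact: e1.
exists (nth x u (index x u).-1) => //=.
rewrite /d /= index_uniq ?su //; last exact: leq_ltn_trans (leq_pred _) xu.
exact: e2.
Qed.

(** Both special edges of the tree of [two_ladders] are incoming. *)
Lemma blow_rel_tent c i u : blow_rel c -> (i.+1 < n)%N -> u \in orders ->
  c (tent i.+1 u) = - c (tent i u).
Proof.
move=> rel lt_in uw; have rt := is_rtree_two_ladders lt_in uw.
move: uw; rewrite mem_permutations => uE.
have su : size u = n by rewrite (perm_size uE) size_enum_ord.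
have mu x : x \in u by rewrite (perm_mem uE) mem_enum.
have uu : uniq u by rewrite (perm_uniq uE) enum_uniq.
pose S : Tree1 n := mk_rtree rt.
have SE a : parent S a = two_ladders i u a by [].
have x0 : 'I_n := Ordinal lt_in; pose a := nth x0 u i; pose b := nth x0 u i.+1.
have ia : index a u = i by rewrite index_uniq ?su // ltnW.
have ib : index b u = i.+1 by rewrite index_uniq ?su.
have ab : b != a by apply/eqP => E; have := ib; rewrite E ia => /n_Sn.
have child x : (parent S (Some x) == Some None) = (x == a) || (x == b).
  have E y : (index x u == index y u) = (x == y).
    by apply/eqP/eqP => [E|->//]; rewrite -(nth_index y (mu x)) E nth_index.
  have Ea : (index x u == i) = (x == a) by rewrite -E ia.
  have Eb : (index x u == i.+1) = (x == b) by rewrite -E ib.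
  by rewrite SE ffunE /= Ea Eb; case: ifP.
have two : (1 < arity S None)%N.
  rewrite arity_special (_ : children S = [set a; b]); last first.
    by apply/setP => x; rewrite !inE child.
  by rewrite cards2 eq_sym ab.
have := rel S two; rewrite special_sum [X in _ - X]big_pred0; last first.
  by move=> y; rewrite SE ffunE.
rewrite subr0 (bigD1 b) /=; last by rewrite child eqxx orbT.
rewrite (big_pred1 a); last first.
  move=> x /=; rewrite child; case: (eqVneq x a) => [->|_] /=; first by rewrite eq_sym.
  by case: (x == b).
have Cb : contract S (Some b, None) = tent i.+1 u.
  apply/ffunP => x; rewrite !ffunE /= [Some x == _](inj_eq (@Some_inj _)).
  case: (eqVneq x b) => [->|xb]; first by rewrite SE ffunE /= ib eqxx.
  rewrite SE ffunE /=; have xi : index x u != i.+1.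
    by apply: contra xb => /eqP xi; rewrite -(nth_index x0 (mu x)) xi.
  rewrite (negPf xi) orbF; case: eqP => [-> /=|/eqP xi'].
    by rewrite ltnS leqnn; congr Some; apply: set_nth_default; rewrite su.
  by rewrite /= ltnS [in RHS]leq_eqVlt (negPf xi').
have Ca : contract S (Some a, None) = tent i u.
  apply/ffunP => x; rewrite !ffunE /= [Some x == _](inj_eq (@Some_inj _)).
  case: (eqVneq x a) => [->|xa]; first by rewrite SE ffunE /= ia eqxx.
  rewrite SE ffunE /=; have xi : index x u != i.
    by apply: contra xa => /eqP xi; rewrite -(nth_index x0 (mu x)) xi.
  rewrite (negPf xi) /=; case: eqP => [-> /=|//].
  by rewrite ltnNge leqnSn /=; congr Some; apply: set_nth_default; rewrite su ltnW.
by rewrite Ca Cb => /eqP; rewrite addr_eq0 => /eqP.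
Qed.

Lemma blow_rel_tent_sign c i u : blow_rel c -> (i < n)%N -> u \in orders ->
  c (tent i u) = (-1) ^+ i *: c (ladder u).
Proof.
move=> rel; elim: i => [|i IH] lt_in uw; first by rewrite expr0 scale1r.
by rewrite blow_rel_tent // IH ?(ltnW lt_in) // exprS mulN1r scaleNr.
Qed.

(** A tree in which no vertex has two children is a ladder.  By induction along w, the parent
    of a vertex is the vertex just before it, since all the earlier ones already have a
    child. *)
Lemma linext_chain U w : w \in orders -> linext (parent U) w ->
  (forall x y p, parent U x = Some p -> parent U y = Some p -> x = y) ->
  val U = ladder w.
Proof.
rewrite mem_permutations => wE /linextP lw inj.
have mw x : x \in w by rewrite (perm_mem wE) mem_enum.
have uw : uniq w by rewrite (perm_uniq wE) enum_uniq.
have [r Ur rU] := rtree_root U.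
have first x : index x w = 0%N -> parent U x = None.
  by move=> x0; case Ux: (parent U x) => [y|//]; have := lw x y (mw x) Ux; rewrite x0.
suff main m x : index x w = m ->
    parent U x = if m == 0%N then None else Some (nth x w m.-1).
  by apply/ffunP => x; rewrite ffunE /= -/(parent U x) (main _ x (erefl _)).
elim/ltn_ind: m x => -[|m] IH x xm; first exact: first.
have sm : (m.+1 < size w)%N by rewrite -xm index_mem.
case Ux: (parent U x) => [y|]; last first.
  have x0 : index (nth x w 0) w = 0%N by rewrite index_uniq // (leq_trans _ sm).
  by move: xm; rewrite (rU x Ux) -(rU _ (first _ x0)) x0.
have := lw x y (mw x) Ux; rewrite xm ltnS leq_eqVlt => /orP[/eqP <-|ym].
  by rewrite /= nth_index.
have sy : ((index y w).+1 < size w)%N by rewrite (leq_ltn_trans ym) // ltnW.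
have zi : index (nth x w (index y w).+1) w = (index y w).+1 by rewrite index_uniq.
have := IH _ _ _ zi; rewrite ltnS ym nth_index // => /(_ isT) /= Uz.
by move: xm; rewrite (inj x _ y Ux Uz) zi => -[ym']; rewrite ym' ltnn in ym.
Qed.

Lemma linext_ladder w w' : w \in orders -> w' \in orders ->
  linext (ladder w) w' = (w == w').
Proof.
rewrite !mem_permutations => wE wE'.
have mw x : x \in w by rewrite (perm_mem wE) mem_enum.
have mw' x : x \in w' by rewrite (perm_mem wE') mem_enum.
have uw : uniq w by rewrite (perm_uniq wE) enum_uniq.
have uw' : uniq w' by rewrite (perm_uniq wE') enum_uniq.
apply/linextP/eqP => [H|<- x y _].
  pose lt x y := (index x w' < index y w')%N.
  have lttr : transitive lt by move=> y x z; apply: ltn_trans.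
  have ltirr : irreflexive lt by move=> x; apply: ltnn.
  apply: (irr_sorted_eq lttr ltirr) => [||x]; last by rewrite mw mw'.
    case w0: w => [//|x0 w0']; rewrite -w0; apply/(sortedP x0) => i iw.
    apply: H => //; rewrite ffunE /= index_uniq //=.
    by congr Some; apply/set_nth_default/ltnW.
  case w0: w' => [//|x0 w0']; rewrite -w0; apply/(sortedP x0) => i iw.
  by rewrite /lt !index_uniq // ltnW.
rewrite ffunE /=; case: eqP => // x0 [<-].
have xw : (index x w < size w)%N by rewrite index_mem.
rewrite index_uniq //; last exact: leq_ltn_trans (leq_pred _) xw.
by rewrite prednK // lt0n; apply/eqP.
Qed.

(** [blow_rel_choose] and [linext_sum] show that both sides behave in the same way when a
    vertex with several children is resolved.  This decreases the number of linear
    extensions, so it leads to ladders, which have a single one. *)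
Lemma blow_rel_linext c U : blow_rel c ->
  c (val U) = \sum_(w <- orders | linext (parent U) w) c (ladder w).
Proof.
move=> rel; have [m] := ubnP (count (linext (parent U)) orders).
elim: m U => // m IH U Um.
have [p two|chain] := pickP (fun p => (1 < #|[set x | parent U x == Some p]|)%N).
  set K := [set x | parent U x == Some p] in two.
  have UK : {in K &, forall x y, val U x = val U y}.
    by move=> x y; rewrite !inE => /eqP + /eqP; rewrite /parent => -> ->.
  rewrite (blow_rel_choose rel two) (linext_sum _ (ltnW two) UK) -/K.
  have chP r : r \in K -> is_rtree (choose_first (val U) K r).
    by rewrite inE => /eqP/is_rtree_choose.
  apply: eq_bigr => r rK; pose Ur : Tree n := mk_rtree (chP r rK).
  apply: (IH Ur); rewrite ltnS in Um; apply: leq_trans Um.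
  have := @linext_sum nat (fun _ => 1%N) (val U) K (ltnW two) UK.
  rewrite [LHS](sum1_count orders (linext (parent U))) => ->.
  rewrite (bigD1 r) //= [X in (_ < X + _)%N](sum1_count orders (linext (choose_first _ K r))).
  rewrite -[X in (X < _)%N]addn0 ltn_add2l.
  have [r' /andP[rK' r'r]] : exists r', (r' \in K) && (r' != r).
    have : (0 < #|K :\ r|)%N by move: two; rewrite (cardsD1 r) rK.
    by case/card_gt0P => r'; rewrite !inE andbC => ?; exists r'; rewrite inE.
  rewrite (bigD1 r') ?rK' //=; apply: ltn_addr.
  rewrite (sum1_count orders (linext (choose_first _ K r'))) -has_count.
  have [w wE lw] := rtree_linext (mk_rtree (chP r' rK')); apply/hasP; exists w => //.
  by rewrite mem_permutations.
have [w0 w0E lw0] := rtree_linext U.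
have w0w : w0 \in orders by rewrite mem_permutations.
have UE : val U = ladder w0.
  apply: (linext_chain w0w lw0) => x y p xp yp; apply/eqP/negPn/negP => xy.
  have /negP[] := chain p; rewrite (cardD1 x) (cardD1 y) !inE xp yp eqxx /=.
  by rewrite eq_sym xy.
rewrite /parent UE; symmetry; transitivity (\sum_(w <- orders | w == w0) c (ladder w)).
  rewrite big_seq_cond [RHS]big_seq_cond; apply: eq_bigl => w.
  by case ww: (w \in orders) => //=; rewrite linext_ladder // eq_sym.
rewrite big_mkcond (bigD1_seq w0) ?permutations_uniq //= eqxx big1 ?addr0 //.
by move=> w /negPf->.
Qed.

(** The sum of (-1) ^ i c (tent i u) has n equal terms, by [blow_rel_tent_sign].  Expanding
    each tent over its linear extensions gives the coefficients of brackets, by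
    [bracket_coef_valley]. *)
Lemma blow_rel_bracket_coef c U : blow_rel c ->
  n%:R *: c (val U) =
  \sum_(u <- orders | linext (parent U) u)
    \sum_(w <- orders) bracket_coef k (rev w) u *: c (ladder w).
Proof.
move=> rel; have n0 : (0 < n)%N.
  by have [r _ _] := rtree_root U; apply: leq_ltn_trans (ltn_ord r).
rewrite (blow_rel_linext U rel) scaler_sumr big_seq_cond [RHS]big_seq_cond.
apply: eq_bigr => u /andP[uw _].
have su : size u = n.
  by move: (uw); rewrite mem_permutations => /perm_size ->; rewrite size_enum_ord.
transitivity (\sum_(i < n) (-1) ^+ i *: c (tent i u)).
  rewrite scaler_nat; transitivity (\sum_(i < n) c (ladder u)).
    by rewrite sumr_const card_ord.
  apply: eq_bigr => i _; rewrite (blow_rel_tent_sign rel (ltn_ord i) uw).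
  by rewrite scalerA -exprMn mulrNN mulr1 expr1n scale1r.
under eq_bigr => i _ do rewrite (blow_rel_linext
  (mk_rtree (is_rtree_tent (ltn_ord i) uw) : Tree n) rel) big_mkcond scaler_sumr.
rewrite exchange_big /= big_seq [RHS]big_seq; apply: eq_bigr => w ww.
have uE : perm_eq u (rev w).
  move: uw ww; rewrite !mem_permutations perm_sym => uE wE.
  by rewrite perm_sym (perm_trans _ uE) // perm_rev.
have wE := ww; rewrite mem_permutations in wE.
rewrite bracket_coef_valley ?rev_uniq ?(perm_uniq wE) ?enum_uniq //; last first.
  by rewrite -size_eq0 size_rev (perm_size wE) size_enum_ord -lt0n.
rewrite /valley_sum su scaler_suml; apply: eq_bigr => i _.
rewrite [parent _]/= -/(linext (tent i u) w) linext_tent //.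
by case: (peaked _ _); rewrite ?mulr1 ?mulr0 ?scale0r ?scaler0.
Qed.

End Relations.

(** * Induction on spans *)

Section PropSubmodule.
Variables (k : fieldType) (M : lmodType k) (P : M -> Prop).
Hypothesis P0 : P 0.
Hypothesis PL : forall (a : k) x y, P x -> P y -> P (a *: x + y).

(** The proofs are arguments so that the closure instance can be attached to this predicate. *)
Definition psub of P 0 & (forall (a : k) x y, P x -> P y -> P (a *: x + y)) : {pred M} :=
  fun x => `[< P x >].

Lemma psub_closed : submod_closed (psub P0 PL).
Proof.
by split=> [|a x y /asboolP Px /asboolP Py]; apply/asboolP; [|apply: PL].
Qed.
HB.instance Definition _ := GRing.isSubmodClosed.Build k M (psub P0 PL) psub_closed.

Lemma lspan_ind (A : M -> Prop) : (forall x, A x -> P x) ->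
  forall x, x \in lspan A -> P x.
Proof.
move=> AP x /asboolP/(_ (psub P0 PL)) H; apply/asboolP/H => y Ay.
exact/asboolP/AP.
Qed.
End PropSubmodule.

Section LieSpanInd.
Variables (k : fieldType) (A : preLieType k) (B P : A -> Prop).

Lemma lie_span_ind : P 0 -> (forall (a : k) x y, P x -> P y -> P (a *: x + y)) ->
  (forall x y, P x -> P y -> P (lie_bracket x y)) -> (forall x, B x -> P x) ->
  forall x, x \in lie_span B -> P x.
Proof.
move=> P0 PL PB BP x /asboolP/(_ (psub P0 PL)) H; apply/asboolP/H.
  by move=> u v /asboolP Pu /asboolP Pv; apply/asboolP/PB.
by move=> y By; apply/asboolP/BP.
Qed.
End LieSpanInd.

(** * The Lie algebra of a pre-Lie algebra *)

Section Bracket.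
Variables (k : fieldType) (A : preLieType k).
Implicit Types x y z : A.

Lemma lie_bracketPl (a : k) x y z :
  lie_bracket (a *: x + y) z = a *: lie_bracket x z + lie_bracket y z.
Proof.
by rewrite /lie_bracket pstar_linearl pstar_linearr scalerBr opprD addrACA.
Qed.

Lemma lie_bracketPr (a : k) x y z :
  lie_bracket z (a *: x + y) = a *: lie_bracket z x + lie_bracket z y.
Proof.
by rewrite /lie_bracket pstar_linearl pstar_linearr scalerBr opprD addrACA.
Qed.

Lemma lie_bracketC x y : lie_bracket x y = - lie_bracket y x.
Proof. by rewrite /lie_bracket opprB. Qed.

Definition bracketr z := fun x => lie_bracket x z.
Lemma bracketr_linear z : linear (bracketr z).
Proof. by move=> a x y; apply: lie_bracketPl. Qed.
HB.instance Definition _ z := GRing.isLinear.Build k A A _ (bracketr z) (bracketr_linear z).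

Definition bracketl z := fun x => lie_bracket z x.
Lemma bracketl_linear z : linear (bracketl z).
Proof. by move=> a x y; apply: lie_bracketPr. Qed.
HB.instance Definition _ z := GRing.isLinear.Build k A A _ (bracketl z) (bracketl_linear z).

Definition pstarR z := fun x => pstar x z.
HB.instance Definition _ z := GRing.isLinear.Build k A A _ (pstarR z) (pstar_linearl z).
Definition pstarL z := fun x => pstar z x.
HB.instance Definition _ z := GRing.isLinear.Build k A A _ (pstarL z) (pstar_linearr z).

Lemma pstarBl x y z : pstar (x - y) z = pstar x z - pstar y z.
Proof. exact: (linearB (pstarR z)). Qed.
Lemma pstarBr x y z : pstar z (x - y) = pstar z x - pstar z y.
Proof. exact: (linearB (pstarL z)). Qed.

(** The combination of three instances of the symmetry of the associator, one for each of the
    three elements in the first place. *)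
Lemma lie_bracket_jacobi x y z :
  lie_bracket (lie_bracket x y) z
  = lie_bracket (lie_bracket x z) y + lie_bracket x (lie_bracket y z).
Proof.
have group_identity (a b c d e f g h i j l m : A) :
    a - b = c - d -> e - f = g - h -> i - j = l - m ->
    a - e - (j - m) = c - i - (f - h) + (b - d - (g - l)).
  move=> /(canRL (subrK _)) -> /(canRL (subrK _)) -> /(canRL (subrK _)) ->.
  rewrite !opprD !opprK !addrA.
  by rewrite [RHS](ACl ((1 * 8 * 7 * 9 * 6 * 5 * 4 * 3) * (2 * 10)))%AC /= addNr addr0.
rewrite /lie_bracket !(pstarBl, pstarBr).
by apply: group_identity; apply: pstar_assoc_sym.
Qed.
End Bracket.

(** * The tensor algebra and left-normed brackets *)

Section WordAlgebra.
Variables (k : fieldType) (V : lmodType k).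

Inductive word_relator : {freeg (seq V) / k} -> Prop :=
| WR s t (a : k) (u w : V) :
    word_relator (fgen k (s ++ (a *: u + w) :: t)
                  - (a *: fgen k (s ++ u :: t) + fgen k (s ++ w :: t))).

(** The tensor algebra of V, presented by words and multilinearity. *)
Definition words : Type := quotmod (lspan word_relator).
HB.instance Definition _ := GRing.Lmodule.on words.

Definition word (s : seq V) : words := pim (lspan word_relator) (fgen k s).

Lemma word_linear s t (a : k) u w :
  word (s ++ (a *: u + w) :: t) = a *: word (s ++ u :: t) + word (s ++ w :: t).
Proof. by rewrite /word -linearP; apply/eqP; rewrite pim_eq; apply/mem_lspan/WR. Qed.

Lemma words_ind (P : words -> Prop) :
  P 0 -> (forall a s x, P x -> P (a *: word s + x)) -> forall x, P x.
Proof.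
move=> P0 PS x; rewrite -[x]repr_pim.
elim/freeg_gen_ind: (repr x) => [|a s y IH]; first by rewrite linear0.
by rewrite linearP; apply: PS.
Qed.

Section Lift.
Variables (M : lmodType k) (f : seq V -> M).
Hypothesis f_linear : forall s t (a : k) u w,
  f (s ++ (a *: u + w) :: t) = a *: f (s ++ u :: t) + f (s ++ w :: t).

Lemma words_lift_subproof x : x \in lspan word_relator -> free_lift f x = 0.
Proof.
move: x; apply: lspan_ind => [|a y z fy fz|_ [s t a u w]]; first exact: linear0.
  by rewrite linearP /= fy fz scaler0 addr0.
by rewrite linearB linearP /= !free_liftE f_linear subrr.
Qed.

Definition words_lift : {linear words -> M} := quot_lift words_lift_subproof.

Lemma words_liftE s : words_lift (word s) = f s.
Proof. exact: etrans (quot_liftE _ _) (free_liftE _ _). Qed.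
End Lift.

Lemma wcat_proof (t : seq V) s s' (a : k) u w :
  word ((s ++ (a *: u + w) :: s') ++ t)
  = a *: word ((s ++ u :: s') ++ t) + word ((s ++ w :: s') ++ t).
Proof. by rewrite -!catA !cat_cons word_linear. Qed.

(** Concatenation is extended to the left factor first, and then, in [wmul], to the right one. *)
Definition wcat t : {linear words -> words} :=
  words_lift (f := fun s => word (s ++ t)) (wcat_proof t).

Lemma wcatE t s : wcat t (word s) = word (s ++ t).
Proof. exact: words_liftE. Qed.

Lemma wcat_linear x s s' (a : k) u w :
  wcat (s ++ (a *: u + w) :: s') x
  = a *: wcat (s ++ u :: s') x + wcat (s ++ w :: s') x.
Proof.
elim/words_ind: x => [|b t x IH]; first by rewrite !linear0 ?scaler0 addr0.
rewrite !linearP /= IH !wcatE !catA word_linear !scalerDr !scalerA (mulrC b).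
by rewrite -!addrA; congr (_ + _); rewrite addrCA.
Qed.

Definition wmul (x y : words) : words :=
  words_lift (f := fun t => wcat t x) (wcat_linear x) y.

Lemma wmulE s t : wmul (word s) (word t) = word (s ++ t).
Proof. by rewrite /wmul words_liftE wcatE. Qed.

Lemma wmul_linearr x : linear (wmul x).
Proof. by move=> a y z; rewrite /wmul linearP. Qed.

Lemma wmul_linearl y : linear (wmul^~ y).
Proof.
move=> a x x'; elim/words_ind: y => [|b t y IH].
  by rewrite /wmul !linear0 ?scaler0 addr0.
rewrite !wmul_linearr IH /wmul !words_liftE linearP !scalerDr !scalerA (mulrC b).
by rewrite -!addrA; congr (_ + _); rewrite addrCA.
Qed.

Lemma wmulA x y z : wmul x (wmul y z) = wmul (wmul x y) z.
Proof.
have w0l y' : wmul 0 y' = 0.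
  by have := wmul_linearl y' (-1) 0 0; rewrite scaler0 addr0 scaleN1r addNr.
have w0r x' : wmul x' 0 = 0 by exact: linear0.
elim/words_ind: x y z => [|a s x IHx] y z; first by rewrite !w0l.
rewrite !wmul_linearl IHx; congr (a *: _ + _).
move: x IHx => _ _; elim/words_ind: y z => [|b t y IHy] z.
  by rewrite !(w0l, w0r).
rewrite !(wmul_linearl, wmul_linearr) IHy; congr (b *: _ + _).
elim/words_ind: z {IHy} => [|c u z IHz]; first by rewrite !w0r.
by rewrite !(wmul_linearl, wmul_linearr) IHz !wmulE catA.
Qed.

Lemma wmul_assoc_sym x y z :
  wmul (wmul x y) z - wmul x (wmul y z) = wmul (wmul x z) y - wmul x (wmul z y).
Proof. by rewrite !wmulA !subrr. Qed.

HB.instance Definition _ := Lmodule_isPreLie.Build k words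
  wmul_linearl wmul_linearr wmul_assoc_sym.

Definition letter (v : V) : words := word [:: v].
Lemma letter_linear : linear letter.
Proof. by move=> a u w; apply: (word_linear [::] [::]). Qed.
HB.instance Definition _ := GRing.isLinear.Build k V words _ letter letter_linear.

(** The universal property of pL(V) applies because an associative product is pre-Lie. *)
Definition expand : {linear pL V -> words} := pL_lift (letter : {linear V -> words}).

(** The letters are listed backwards, as for [bracket_sum]. *)
Fixpoint left_normed (r : seq V) : pL V :=
  match r with
  | [::] => 0
  | z :: r' => if r' is [::] then pLi z else lie_bracket (left_normed r') (pLi z)
  end.

Lemma left_normedS z r : r != [::] -> left_normed (z :: r) = lie_bracket (left_normed r) (pLi z).
Proof. by case: r. Qed.

Lemma expand_left_normed r : expand (left_normed r) = bracket_sum word r.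
Proof.
elim: r => [|z r IH]; first exact: linear0.
have [->|r0] := eqVneq r [::]; first exact: pL_lift_gen.
rewrite left_normedS // bracket_sumS // bracket_sumB /lie_bracket linearB !pL_lift_star.
rewrite -/expand IH !pL_lift_gen.
pose lr : {linear words -> words} := pstarR (letter z).
pose ll : {linear words -> words} := pstarL (letter z).
rewrite -[pstar (bracket_sum _ _) _]/(lr _) -[pstar (letter z) _]/(ll _).
rewrite (bracket_sum_linear lr) (bracket_sum_linear ll).
by congr (_ - _); apply: eq_bracket_sum => u _; rewrite /= -?cats1; apply: wmulE.
Qed.

(** By induction on the second bracket, with [x, [y, z]] = [[x, y], z] - [[x, z], y]. *)
Lemma left_normed_closed x y : x \in lspan (fun x => exists r, x = left_normed r) ->
  y \in lspan (fun x => exists r, x = left_normed r) ->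
  lie_bracket x y \in lspan (fun x => exists r, x = left_normed r).
Proof.
set A := fun x : pL V => _; move=> xA yA; move: y yA x xA.
have br0l (x : pL V) : lie_bracket x 0 = 0 by exact: (linear0 (bracketl x)).
have br0r (x : pL V) : lie_bracket 0 x = 0 by exact: (linear0 (bracketr x)).
apply: lspan_ind => [x _|a y z IHy IHz x xA|_ [s ->]].
- by rewrite br0l rpred0.
- by rewrite lie_bracketPr rpredD ?rpredZ ?IHy ?IHz.
elim: s => [|z s IH] x xA; first by rewrite br0l rpred0.
have step y : y \in lspan A -> lie_bracket y (pLi z) \in lspan A.
  move: y; apply: lspan_ind => [|a y y' IHy IHy'|_ [r ->]].
  - by rewrite br0r rpred0.
  - by rewrite lie_bracketPl rpredD ?rpredZ.
  have [->|r0] := eqVneq r [::]; first by rewrite br0r rpred0.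
  by apply: mem_lspan; exists (z :: r); rewrite left_normedS.
have [->|s0] := eqVneq s [::]; first exact: step.
have := lie_bracket_jacobi x (left_normed s) (pLi z).
rewrite left_normedS // => /(canLR (addKr _)) <-.
rewrite rpredD ?rpredN //; last by apply/step/IH.
by apply/IH/step.
Qed.

Lemma L_left_normed x : x \in @L k V -> x \in lspan (fun x => exists r, x = left_normed r).
Proof.
move: x; apply: lie_span_ind => [|a x y xL yL|x y|_ [v ->]].
- exact: rpred0.
- by rewrite rpredD ?rpredZ.
- exact: left_normed_closed.
- by apply: mem_lspan; exists [:: v].
Qed.

Lemma left_normed_L r : left_normed r \in @L k V.
Proof.
have pLiL v : pLi v \in @L k V by apply: mem_lie_span; exists v.
elim: r => [|z r IH]; first exact: rpred0.
have [->|r0] := eqVneq r [::]; first exact: pLiL.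
by rewrite left_normedS //; apply: lie_span_closed.
Qed.

(** The right action of the tensor algebra on pL(V) that extends the adjoint action of V. *)
Definition ad_word (x : pL V) (s : seq V) : pL V := foldl (fun y v => lie_bracket y (pLi v)) x s.

Lemma ad_word_linearl s : linear (ad_word^~ s).
Proof. by elim: s => // v s IH a x y; rewrite /= lie_bracketPl; apply: IH. Qed.

Lemma ad_word_linearr x s t (a : k) u w :
  ad_word x (s ++ (a *: u + w) :: t) = a *: ad_word x (s ++ u :: t) + ad_word x (s ++ w :: t).
Proof.
by rewrite /ad_word !foldl_cat /= linearP lie_bracketPr -ad_word_linearl.
Qed.

(** The left-normed bracket of a word, read forwards. *)
Definition left_normed_word (s : seq V) : pL V := if s is z :: t then ad_word (pLi z) t else 0.

(** The adjoint action is a Lie action, so the action of the expansion of a bracket is the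
    bracket with it. *)
Lemma bracket_sum_ad_word x r : r != [::] ->
  bracket_sum (ad_word x) r = lie_bracket x (left_normed r).
Proof.
elim: r x => // z r IH x _; have [->//|r0] := eqVneq r [::].
rewrite bracket_sumS // left_normedS // bracket_sumB.
transitivity (bracket_sum (fun u => bracketr (pLi z) (ad_word x u)) r
              - bracket_sum (ad_word (lie_bracket x (pLi z))) r).
  by congr (_ - _); apply: eq_bracket_sum => u _; rewrite /ad_word -?cats1 ?foldl_cat.
rewrite -(bracket_sum_linear (bracketr (pLi z)) (ad_word x)).
rewrite !IH // -[LHS]/(lie_bracket (lie_bracket x (left_normed r)) (pLi z) - _).
rewrite (lie_bracket_jacobi x (left_normed r)).
by rewrite addrAC subrr add0r.
Qed.

(** Bracketing the words in the expansion of a bracket of n letters multiplies it by n: when z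
    is put at the left, [bracket_sum_ad_word] gives [z, y], which together with the sign adds
    one copy of [y, z] to those obtained by induction. *)
Lemma bracket_sum_left_normed_word r :
  bracket_sum left_normed_word r = (size r)%:R *: left_normed r.
Proof.
elim: r => [|z r IH]; first by rewrite scaler0.
have [->|r0] := eqVneq r [::]; first by rewrite scale1r.
rewrite bracket_sumS // bracket_sumB left_normedS // [size _]/= -natr1 scalerDl scale1r.
transitivity (bracket_sum (fun u => bracketr (pLi z) (left_normed_word u)) r
              - bracket_sum (ad_word (pLi z)) r).
  congr (_ - _); apply: eq_bracket_sum => -[|v u].
    by move/perm_size/esym/size0nil/eqP; rewrite (negPf r0).
  by move=> _; rewrite -cats1 /= /ad_word foldl_cat.
rewrite -(bracket_sum_linear (bracketr (pLi z)) left_normed_word) bracket_sum_ad_word //.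
rewrite IH linearZ /=.
by rewrite (lie_bracketC (pLi z)) opprK.
Qed.

Lemma dynkin_proof s t (a : k) u w :
  (size (s ++ (a *: u + w) :: t))%:R^-1 *: left_normed_word (s ++ (a *: u + w) :: t)
  = a *: ((size (s ++ u :: t))%:R^-1 *: left_normed_word (s ++ u :: t))
    + (size (s ++ w :: t))%:R^-1 *: left_normed_word (s ++ w :: t) :> pL V.
Proof.
rewrite !size_cat /= scalerA (mulrC a) -scalerA -scalerDr; congr (_ *: _).
case: s => [|z s] /=; first by rewrite linearP ad_word_linearl.
exact: ad_word_linearr.
Qed.

Definition dynkin : {linear words -> pL V} :=
  words_lift (f := fun s => (size s)%:R^-1 *: left_normed_word s) dynkin_proof.

(** The theorem of Dynkin, Specht and Wever: L(V) is spanned by left-normed brackets, for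
    which it is [bracket_sum_left_normed_word]. *)
Lemma dynkin_expand : [pchar k] =i pred0 ->
  forall x, x \in @L k V -> dynkin (expand x) = x.
Proof.
move=> char_k x /L_left_normed; move: x; apply: lspan_ind => [|a x y dx dy|_ [r ->]].
- by rewrite !linear0.
- by rewrite !linearP /= dx dy.
rewrite expand_left_normed bracket_sum_linear.
have [->//|r0] := eqVneq r [::].
transitivity (bracket_sum (fun u => (size r)%:R^-1 *: left_normed_word u) r).
  by apply: eq_bracket_sum => u /perm_size <-; apply: words_liftE.
rewrite bracket_sumZ bracket_sum_left_normed_word scalerA mulVf ?scale1r //.
by move/pcharf0P: char_k => ->; rewrite size_eq0.
Qed.

End WordAlgebra.

(** * Maps out of decorated structures *)

Section DecoratedInd.
Variables (k : fieldType) (X : nat -> finType).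
Variable to : forall n, {action {perm 'I_n} &-> X n}.
Variable V : lmodType k.

Lemma deco_ind (P : decorated to V -> Prop) :
  P 0 -> (forall a n (T : X n) v x, P x -> P (a *: deco to T v + x)) -> forall x, P x.
Proof.
move=> P0 PS x; rewrite -[x]repr_pim.
elim/freeg_gen_ind: (repr x) => [|a [n [T v]] y IH]; first by rewrite linear0.
by rewrite linearP; apply: PS.
Qed.

Section Degree.
Variables (n : nat) (M : lmodType k) (g : X n -> {ffun 'I_n -> V} -> M).
Hypothesis g_linear : forall (T : X n) v i (a : k) (u w : V),
  g T (upd v i (a *: u + w)) = a *: g T (upd v i u) + g T (upd v i w).
Hypothesis g_balanced : forall (T : X n) v (s : {perm 'I_n}),
  g (to n T s) v = g T [ffun j => v (s j)].

(** An operation that is only given on structures with n vertices is extended by zero to the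
    others; the match transports it along n = m. *)
Definition in_degree m : X m -> {ffun 'I_m -> V} -> M :=
  match eq_comparable n m with
  | left e => match e in _ = m return X m -> {ffun 'I_m -> V} -> M with erefl => g end
  | right _ => fun _ _ => 0
  end.

Lemma in_degree_linear m (T : X m) v i (a : k) (u w : V) :
  in_degree T (upd v i (a *: u + w))
  = a *: in_degree T (upd v i u) + in_degree T (upd v i w).
Proof.
rewrite /in_degree; case: eq_comparable => [e|_]; last by rewrite scaler0 addr0.
by case: m / e T v i => T v i /=; apply: g_linear.
Qed.

Lemma in_degree_balanced m (T : X m) v (s : {perm 'I_m}) :
  in_degree (to m T s) v = in_degree T [ffun j => v (s j)].
Proof.
rewrite /in_degree; case: eq_comparable => [e|_] //.
by case: m / e T v s => T v s /=; apply: g_balanced.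
Qed.

Definition degree_lift : {linear decorated to V -> M} :=
  deco_lift in_degree_linear in_degree_balanced.

Lemma degree_liftE T v : degree_lift (deco to T v) = g T v.
Proof.
rewrite deco_liftE /in_degree; case: eq_comparable => [e|//].
by rewrite (eq_irrelevance e erefl).
Qed.

Lemma degree_lift0 m (T : X m) v : m != n -> degree_lift (deco to T v) = 0.
Proof.
move=> mn; rewrite deco_liftE /in_degree; case: eq_comparable => [e|//].
by rewrite e eqxx in mn.
Qed.
End Degree.

Section Projection.
Variable n : nat.
Definition degree_proj : {linear decorated to V -> decorated to V} :=
  degree_lift (@deco_linear k X to V n) (@deco_balanced k X to V n).
End Projection.

Lemma degree_proj_sum x : exists N, x = \sum_(n < N) degree_proj n x.
Proof.
suff [N HN] : exists N, forall N', (N <= N')%N -> x = \sum_(n < N') degree_proj n x.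
  by exists N; apply: HN.
elim/deco_ind: x => [|a m T v x [N HN]].
  by exists 0%N => N' _; rewrite big1 // => i _; rewrite linear0.
exists (maxn m.+1 N) => N'; rewrite geq_max => /andP[mN' NN'].
under eq_bigr => i _ do rewrite linearP.
rewrite big_split /= -HN // -scaler_sumr (bigD1 (Ordinal mN')) //=.
rewrite degree_liftE big1 ?addr0 // => i im; rewrite degree_lift0 //.
by apply: contra im => /eqP im; apply/eqP/val_inj.
Qed.

End DecoratedInd.

Lemma relabel_funM (T : finType) (p : {ffun T -> option T}) s t :
  relabel_fun p (s * t) = relabel_fun (relabel_fun p s) t.
Proof.
apply/ffunP => x; rewrite !ffunE invMg permM.
by case: (p _) => //= y; rewrite permM.
Qed.

Lemma linext_relabel (T : finType) (t : rtree T) s (w : seq T) :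
  linext (parent (relabel t s)) (map s w) = linext (parent t) w.
Proof.
rewrite /linext all_map; apply: eq_all => x /=.
rewrite parent_relabel permK; case: (parent t x) => //= y.
by rewrite !(index_map (@perm_inj _ s)).
Qed.

(** * Sums over the orderings of the vertices *)

Section Orders.
Variable n : nat.
Local Notation orders := (permutations (enum 'I_n)).

Lemma orders_perm u : u \in orders -> exists s : {perm 'I_n}, u = map s (enum 'I_n).
Proof.
rewrite mem_permutations => uE; have su : size u = n.
  by rewrite (perm_size uE) size_enum_ord.
have uu : uniq u by rewrite (perm_uniq uE) enum_uniq.
have nthI : injective (fun i : 'I_n => nth i u i).
  move=> i j E; apply/val_inj/eqP; rewrite -(nth_uniq i _ _ uu) ?su //= E.
  by apply/eqP/set_nth_default; rewrite su.
have [s sE] : exists s : {perm 'I_n}, forall i, s i = nth i u i.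
  by exists (perm nthI) => i; rewrite permE.
exists s; case: n u su s sE {uE uu nthI} => [|m] u su s sE.
  by rewrite (size0nil su) enum_ord0.
apply: (@eq_from_nth _ ord0) => [|i]; first by rewrite size_map size_enum_ord.
rewrite su => im; rewrite (nth_map ord0) ?size_enum_ord // sE.
rewrite (nth_enum_ord _ im); apply: set_nth_default.
by rewrite su.
Qed.

Lemma map_perm_orders (s : {perm 'I_n}) u : (map s u \in orders) = (u \in orders).
Proof.
have E : perm_eq (map s (enum 'I_n)) (enum 'I_n).
  have eu := enum_uniq 'I_n; apply: uniq_perm => //.
    by rewrite map_inj_uniq //; apply: perm_inj.
  move=> x; rewrite mem_enum [RHS]inE; apply/mapP; exists (s^-1%g x).
    by rewrite mem_enum.
  by rewrite permKV.
rewrite !mem_permutations; apply/idP/idP => H; last first.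
  by apply: perm_trans E; apply: perm_map.
apply/(perm_map_inj (@perm_inj _ s)); apply: perm_trans H _.
by rewrite perm_sym.
Qed.

Lemma orders_reindex (M : nmodType) (s : {perm 'I_n}) (P : pred (seq 'I_n))
    (F : seq 'I_n -> M) :
  \sum_(u <- orders | P u) F u = \sum_(u <- orders | P (map s u)) F (map s u).
Proof.
rewrite -(big_map (map s) P F); apply: perm_big.
apply: uniq_perm; rewrite ?map_inj_uniq ?permutations_uniq //.
  exact/inj_map/perm_inj.
move=> u; apply/idP/mapP => [uw|[v vw ->]]; last by rewrite map_perm_orders.
have E : map s (map s^-1%g u) = u.
  by rewrite -map_comp map_id_in // => x _ /=; rewrite permKV.
exists (map s^-1%g u); last by rewrite E.
by rewrite -(map_perm_orders s) E.
Qed.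

Lemma map_ffun_nth (V : zmodType) (r : seq V) : size r = n ->
  map [ffun i : 'I_n => r`_i] (enum 'I_n) = r.
Proof.
move=> sr; apply: (@eq_from_nth _ 0); first by rewrite size_map size_enum_ord sr.
move=> i; rewrite size_map size_enum_ord => im.
by rewrite (nth_map (Ordinal im)) ?size_enum_ord // ffunE nth_enum_ord.
Qed.
End Orders.

(** * Growing trees from words *)

Section Grow.
Variables (k : fieldType) (V : lmodType k).

Definition increasing_sum n (s : seq V) : Tr V :=
  \sum_(T : Tree n | linext (parent T) (enum 'I_n)) deco tree_act T [ffun i : 'I_n => s`_i].

Lemma increasing_sum_linear s t (a : k) u w :
  increasing_sum (size (s ++ (a *: u + w) :: t)) (s ++ (a *: u + w) :: t)
  = a *: increasing_sum (size (s ++ u :: t)) (s ++ u :: t)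
    + increasing_sum (size (s ++ w :: t)) (s ++ w :: t).
Proof.
rewrite !size_cat /=; set n := (size s + (size t).+1)%N.
have lt_sn : (size s < n)%N by rewrite /n addnS ltnS leq_addr.
have E x : [ffun i : 'I_n => (s ++ x :: t)`_i]
    = upd [ffun i : 'I_n => (s ++ 0 :: t)`_i] (Ordinal lt_sn) x.
  apply/ffunP => i; rewrite !ffunE !nth_cat -val_eqE /=.
  case: ltngtP => // [si|->]; last by rewrite subnn.
  by rewrite -(subnSK si) /=.
rewrite /increasing_sum scaler_sumr -big_split; apply: eq_bigr => T _.
by rewrite (E (a *: u + w)) (E u) (E w) deco_linear.
Qed.

(** This is the iterated product ((v_1 * v_2) * ..) * v_n in the pre-Lie algebra of trees, in
    which each new vertex is grafted in all possible ways. *)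
Definition grow : {linear words V -> Tr V} :=
  words_lift (f := fun s => increasing_sum (size s) s) increasing_sum_linear.

(** Reordering the letters amounts to relabelling the trees, which turns increasing trees into
    those of which u is a linear extension. *)
Lemma grow_word n (v : {ffun 'I_n -> V}) u : u \in permutations (enum 'I_n) ->
  grow (word (map v u)) = \sum_(T : Tree n | linext (parent T) u) deco tree_act T v.
Proof.
move=> uw; rewrite [LHS]words_liftE.
have -> : size (map v u) = n.
  by move: uw; rewrite mem_permutations size_map => /perm_size ->; rewrite size_enum_ord.
have [s ->] := orders_perm uw; rewrite /increasing_sum.
rewrite [RHS](reindex_inj (act_inj (tree_act n) s)) /=.
apply: eq_big => [T|T _]; first by rewrite linext_relabel.
rewrite deco_balanced; congr deco; apply/ffunP => i; rewrite !ffunE -map_comp.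
by rewrite (nth_map i) ?size_enum_ord // nth_ord_enum.
Qed.

End Grow.

(** * Lie elements are in the kernel *)

Section DeltaGrow.
Variables (k : fieldType) (V : lmodType k) (n : nat).
Local Notation orders := (permutations (enum 'I_n)).
Local Notation sg e := (if e.2 == None then 1 else -1 : k).

(** The coefficient of S is the signed sum of the trees S / e of which u is a linear extension.
    By [linext_sum] the incoming edges contribute that of [detach S]; this is also the
    contribution of the outgoing edge when there is one. *)
Lemma delta_grow_word (v : {ffun 'I_n -> V}) u : u \in orders ->
  delta V (grow V (word (map v u))) =
  \sum_(S : Tree1 n | (1 < arity S None)%N && (parent S None == None))
     (linext (detach S) u)%:R *: deco tree1_act S v.
Proof.
move=> uw; rewrite grow_word // linear_sum.
transitivity (\sum_(T : Tree n | linext (parent T) u) delta_gen T v).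
  by apply: eq_bigr => T _; apply: deltaE.
rewrite /delta_gen.
transitivity (\sum_(S : Tree1 n | (1 < arity S None)%N)
   (\sum_(e in edges S | special e) sg e * (linext (contract S e) u)%:R)
     *: (deco tree1_act S v : Tr1 V)).
  rewrite (exchange_big_dep xpredT) //=.
  transitivity (\sum_(b : Tree1 n * (option 'I_n * option 'I_n) |
      [&& (1 < arity b.1 None)%N, b.2 \in edges b.1 & special b.2])
      (sg b.2 * (linext (contract b.1 b.2) u)%:R) *: (deco tree1_act b.1 v : Tr1 V)).
    rewrite [RHS]big_mkcond; apply: eq_bigr => -[S e] _ /=.
    case: ifP => [/and3P[two eS se]|nb]; last first.
      rewrite big_pred0 // => T; apply/negP => /andP[_].
      by rewrite inE => /and4P[/= eS se _ two]; rewrite two eS se in nb.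
    pose T0 := mk_rtree (is_rtree_contract eS se).
    have bE T : ((S, e) \in bl T) = (T == T0).
      by rewrite inE /= eS se two andbT /= eq_sym.
    under eq_bigl => T do rewrite bE.
    rewrite (eq_bigl (fun T => (T == T0) && linext (contract S e) u)); last first.
      by move=> T; rewrite andbC; case: eqP => [->|].
    case: (linext (contract S e) u).
      rewrite (big_pred1 T0) => [|T]; last by rewrite andbT.
      by rewrite /bl_sign /= mulr1.
    by rewrite big_pred0 ?mulr0 ?scale0r // => T; rewrite andbF.
  rewrite -(pair_big_dep (fun S : Tree1 n => (1 < arity S None)%N)
     (fun (S : Tree1 n) e => (e \in edges S) && special e)
     (fun S e => (sg e * (linext (contract S e) u)%:R)
                   *: (deco tree1_act S v : Tr1 V))) /=.
  by apply: eq_bigr => S two; rewrite scaler_suml.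
rewrite big_mkcondr; apply: eq_bigr => S two.
rewrite [X in X *: _](special_sum (fun p => (linext p u)%:R : k^o)).
have K0 : (0 < #|children S|)%N by rewrite -arity_special ltnW.
have K1 : (linext (detach S) u)%:R =
    \sum_(x | parent S (Some x) == Some None) (linext (contract S (Some x, None)) u)%:R :> k^o.
  have := linext_sum (fun w => (w == u)%:R : k^o) K0 (@detach_children _ S).
  have E (p : {ffun 'I_n -> option 'I_n}) :
      \sum_(w <- orders | linext p w) ((w == u)%:R : k^o) = (linext p u)%:R.
    rewrite big_mkcond (bigD1_seq u) ?permutations_uniq //= eqxx big1 ?addr0.
      by case: (linext p u).
    by move=> w /negPf->; case: (linext p w).
  rewrite E => ->; apply: eq_big => [x|x xS]; first by rewrite inE.
  by rewrite E contract_in.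
rewrite -K1; case SN: (parent S None) => [[p|]|].
- rewrite (big_pred1 p) => [|y]; last by apply/eqP/eqP => [[->]|->].
  by rewrite contract_out // subrr scale0r.
- by move: (parent_neq S None); rewrite SN eqxx.
- by rewrite big_pred0 ?subr0 // => y.
Qed.

End DeltaGrow.

Section DeltaLie.
Variables (k : fieldType) (V : lmodType k).

Lemma grow_expand_left_normed (r : seq V) :
  grow V (expand V (left_normed r)) = bracket_sum (fun u => grow V (word u)) r.
Proof. by rewrite expand_left_normed bracket_sum_linear. Qed.

(** A functional that counts linear extensions of forests vanishes on brackets, and [detach S]
    has a root for each child of the special vertex. *)
Lemma delta_grow_left_normed (r : seq V) : delta V (grow V (expand V (left_normed r))) = 0.
Proof.
rewrite grow_expand_left_normed bracket_sum_linear.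
set n := size r; pose v : {ffun 'I_n -> V} := [ffun i : 'I_n => r`_i].
rewrite -(map_ffun_nth (erefl : size r = n)) -/v bracket_sum_map.
transitivity (bracket_sum (fun u =>
   \sum_(S : Tree1 n | (1 < arity S None)%N && (parent S None == None))
     (linext (detach S) u)%:R *: (deco tree1_act S v : Tr1 V)) (enum 'I_n)).
  by apply: eq_bracket_sum => u uE; apply: delta_grow_word; rewrite mem_permutations.
rewrite bracket_sum_sum big1 // => S /andP[two /eqP SN].
rewrite (bracket_sumZl (fun u => (linext (detach S) u)%:R)) bracket_sum_linext_eq0 ?scale0r //.
- exact: enum_uniq.
- by move=> x y _ _; rewrite mem_enum.
rewrite -sum1_count big_enum_cond /= sum1_card -/(arity S None).
apply: leq_trans two _; rewrite arity_special; apply: subset_leq_card.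
apply/subsetP => x; rewrite inE => /eqP Sx; change (detach S x == None).
by rewrite ffunE Sx /= SN.
Qed.

End DeltaLie.

(** * The kernel consists of Lie elements *)

Section Coefficient.
Variables (k : fieldType) (X : nat -> finType).
Variable to : forall n, {action {perm 'I_n} &-> X n}.
Variables (V : lmodType k) (n : nat) (U : Tree n).
Variable P : {perm 'I_n} -> pred (X n).
Hypothesis P_equiv : forall s t x, P (s * t)%g (to n x t) = P s x.

(** A coefficient of x, valued in decorations: if the vertices of x can be identified with a
    given structure, the decorations are carried to the tree U.  The sum over all
    identifications makes it invariant under relabelling.  The condition P s x says that
    s is such an identification. *)
Definition coef_gen (x : X n) (v : {ffun 'I_n -> V}) : Tr V :=
  \sum_(s | P s x) deco tree_act (tree_act n U s) v.

Lemma coef_linear x v i (a : k) (u w : V) :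
  coef_gen x (upd v i (a *: u + w))
  = a *: coef_gen x (upd v i u) + coef_gen x (upd v i w).
Proof.
rewrite /coef_gen scaler_sumr -big_split; apply: eq_bigr => s _.
exact: (deco_linear tree_act).
Qed.

Lemma coef_balanced x v (t : {perm 'I_n}) :
  coef_gen (to n x t) v = coef_gen x [ffun j => v (t j)].
Proof.
rewrite /coef_gen (reindex_inj (mulIg t)); apply: eq_big => [s|s _]; first exact: P_equiv.
by rewrite actM; exact: (deco_balanced tree_act).
Qed.

Definition coef : {linear decorated to V -> Tr V} :=
  degree_lift coef_linear coef_balanced.
End Coefficient.

Section TreeCoefficient.
Variables (k : fieldType) (V : lmodType k) (n : nat) (U : Tree n).

Lemma tree_equiv (p : {ffun 'I_n -> option 'I_n}) s t (T : Tree n) :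
  (relabel_fun p (s * t) == val (tree_act n T t)) = (relabel_fun p s == val T).
Proof. by rewrite relabel_funM (inj_eq (@relabel_fun_inj _ t)). Qed.

Lemma tree1_equiv (S : Tree1 n) s t (S' : Tree1 n) :
  (relabel_o S (s * t)%g == tree1_act n S' t) = (relabel_o S s == S').
Proof. by rewrite relabel_oM; apply: (inj_eq (act_inj (tree1_act n) t)). Qed.

Definition tree_coef (p : {ffun 'I_n -> option 'I_n}) : {linear Tr V -> Tr V} :=
  coef V U (P := fun s T => relabel_fun p s == val T) (tree_equiv p).

Definition tree1_coef (S : Tree1 n) : {linear Tr1 V -> Tr V} :=
  coef V U (P := fun s S' => relabel_o S s == S') (tree1_equiv S).

(** For a fixed identification s, the blow-ups of T whose tree is relabelled from S are the
    special edges e of S for which the contraction is relabelled to T. *)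
Lemma tree1_coef_delta (S : Tree1 n) x : (1 < arity S None)%N ->
  tree1_coef S (delta V x) =
  \sum_(e in edges S | special e)
     (if e.2 == None then 1 else -1 : k) *: tree_coef (contract S e) x.
Proof.
move=> two; elim/deco_ind: x => [|a m T v x IH].
  by rewrite !linear0 big1 // => e _; rewrite linear0 scaler0.
rewrite !linearP IH.
under [in RHS]eq_bigr => e _ do rewrite linearP scalerDr scalerA mulrC -scalerA.
rewrite big_split -scaler_sumr; congr (a *: _ + _).
rewrite [X in tree1_coef S X = _]deltaE /delta_gen linear_sum.
have [nm|mn] := eqVneq m n; last first.
  rewrite !big1 // => [e _|b _]; first by rewrite degree_lift0 // scaler0.
  by rewrite linearZ /= degree_lift0 // scaler0.
move: T v; rewrite nm => T v {m nm IH}.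
transitivity (\sum_(b in bl T) \sum_(s | relabel_o S s == b.1)
    bl_sign k b *: (deco tree_act (tree_act n U s) v : Tr V)).
  by apply: eq_bigr => b _; rewrite linearZ /= degree_liftE scaler_sumr.
rewrite (exchange_big_dep xpredT) //=.
under [RHS]eq_bigr => e _ do rewrite degree_liftE scaler_sumr.
rewrite [RHS](exchange_big_dep xpredT) //=; apply: eq_bigr => s _.
pose h (e : option 'I_n * option 'I_n) :=
  (relabel_o S s, (omap s e.1, omap s e.2)) : Tree1 n * _.
pose h' (b : Tree1 n * (option 'I_n * option 'I_n)) :=
  (omap s^-1%g b.2.1, omap s^-1%g b.2.2).
have oK : cancel (omap s^-1%g) (omap s) by case=> //= y; rewrite permKV.
have oKV : cancel (omap s) (omap s^-1%g) by case=> //= y; rewrite permK.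
rewrite (reindex_onto h h') => [|[S' [e1 e2]] /andP[_ /eqP/= <-]]; last first.
  by rewrite /h /h' /= !oK.
apply: eq_big => [e|e _]; last by rewrite /bl_sign /=; case: e.2.
have hE : h e = bl_relabel s (S, e) by [].
rewrite /h' /= !oKV -surjective_pairing !eqxx !andbT.
rewrite !inE /= arity_relabel contract_relabel parent_oext two andbT -andbA.
congr [&& _, _ & _]; last by rewrite /special; case: e {hE} => -[?|] [?|].
rewrite -[Some (omap s e.2)]/(omap (omap s) (Some e.2)).
by apply: inj_eq => -[i|] [j|] // [/oext_inj ->].
Qed.

Lemma blow_rel_coef x : x \in kernel (delta V) -> blow_rel (tree_coef ^~ x).
Proof.
move=> /eqP dx S two; rewrite -tree1_coef_delta // dx; exact: linear0.
Qed.

End TreeCoefficient.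

Section KernelInImage.
Variables (k : fieldType) (V : lmodType k).
Hypothesis char_k : [pchar k] =i pred0.

Definition lie_tree (r : seq V) : Tr V := grow V (expand V (left_normed r)).

Local Notation lie_trees := (lspan (fun y => exists r, y = lie_tree r)).

(** Carrying each coefficient back to its own tree identifies the vertices in n! ways. *)
Lemma sum_tree_coef n x :
  \sum_(U : Tree n) tree_coef V U (val U) x = n`!%:R *: degree_proj tree_act V n x.
Proof.
elim/deco_ind: x => [|a m T v x IH].
  by rewrite linear0 scaler0 big1 // => U _; rewrite linear0.
under eq_bigr => U _ do rewrite linearP.
rewrite big_split -scaler_sumr IH linearP scalerDr scalerA mulrC -scalerA.
congr (a *: _ + _); have [nm|mn] := eqVneq m n; last first.
  by rewrite big1 => [|U _]; rewrite degree_lift0 // scaler0.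
move: T v; rewrite nm => T v {m nm IH}.
under eq_bigr => U _ do rewrite degree_liftE.
rewrite degree_liftE (exchange_big_dep xpredT) //=.
transitivity (\sum_(s : {perm 'I_n}) (deco tree_act T v : Tr V)).
  have TK s : relabel (relabel T s^-1%g) s = T by rewrite -relabelM mulVg relabel1.
  apply: eq_bigr => s _; rewrite (big_pred1 (relabel T s^-1%g)); first by rewrite /= TK.
  move=> U; apply/eqP/eqP => [E|->]; last by rewrite -[RHS](congr1 val (TK s)).
  have <- : relabel U s = T by apply: val_inj.
  by rewrite -relabelM mulgV relabel1.
rewrite sumr_const scaler_nat; congr (_ *+ _).
exact: card_Sn.
Qed.

(** The coefficients on the ladder w of decorated trees are decorations of w; the combination
    over u and U with [bracket_coef] rebuilds the image of their left-normed bracket. *)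
Lemma word_coef_lie n (w : seq 'I_n) x : w \in permutations (enum 'I_n) ->
  \sum_(U : Tree n) \sum_(u <- permutations (enum 'I_n) | linext (parent U) u)
     bracket_coef k (rev w) u *: tree_coef V U (ladder w) x \in lie_trees.
Proof.
move=> ww; elim/deco_ind: x => [|a m T v x IH].
  rewrite big1 ?rpred0 // => U _; rewrite big1 // => u _.
  by rewrite linear0 scaler0.
pose G y := \sum_(U : Tree n) \sum_(u <- permutations (enum 'I_n) | linext (parent U) u)
     bracket_coef k (rev w) u *: tree_coef V U (ladder w) y.
have GP y z : G (a *: y + z) = a *: G y + G z.
  rewrite /G scaler_sumr -big_split; apply: eq_bigr => U _.
  rewrite scaler_sumr -big_split; apply: eq_bigr => u _.
  by rewrite linearP scalerDr !scalerA (mulrC a).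
rewrite -/(G _) GP rpredD ?rpredZ //.
have [nm|mn] := eqVneq m n; last first.
  rewrite /G big1 ?rpred0 // => U _; rewrite big1 // => u _.
  by rewrite degree_lift0 // scaler0.
move: T v; rewrite nm => T v {m nm IH GP}; rewrite /G {G}.
under eq_bigr => U _ do under eq_bigr => u _ do rewrite degree_liftE scaler_sumr.
under eq_bigr => U _ do rewrite exchange_big.
rewrite exchange_big rpred_sum // => s _.
have wE : perm_eq (rev w) (enum 'I_n) by rewrite perm_rev -mem_permutations.
apply: mem_lspan; exists (map [ffun j => v (s j)] (rev w)).
rewrite /lie_tree grow_expand_left_normed bracket_sum_map.
rewrite bracket_sum_bracket_coef ?(perm_uniq wE) ?enum_uniq //.
transitivity (\sum_(u <- permutations (enum 'I_n)) bracket_coef k (rev w) u *: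
    grow V (word (map [ffun j => v (s j)] u))); last first.
  apply: perm_big; apply: uniq_perm; rewrite ?permutations_uniq // => u.
  by rewrite !mem_permutations (permPr wE).
rewrite (exchange_big_dep xpredT) //= big_seq [RHS]big_seq; apply: eq_bigr => u uw.
rewrite grow_word // scaler_sumr; apply: eq_bigr => U _.
by congr (_ *: _); apply: (deco_balanced tree_act).
Qed.

(** In each degree, [blow_rel_bracket_coef] applied to the coefficients of x writes n n! times
    x as a sum of the elements of [word_coef_lie]. *)
Lemma kernel_lie_trees x : x \in kernel (delta V) -> x \in lie_trees.
Proof.
move=> dx; have [N ->] := degree_proj_sum x; rewrite rpred_sum // => -[n /= _] _.
have natr_neq0 m : (0 < m)%N -> m%:R != 0 :> k.
  by move/pcharf0P: char_k => -> m0; rewrite -lt0n.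
have := sum_tree_coef n x; case: n => [|n] E.
  move: E; rewrite big_pred0 => [|U]; last by have [[]] := rtree_root U.
  by rewrite scale1r => <-; rewrite rpred0.
set m := n.+1 in E *; have rel U := @blow_rel_coef k V m U x dx.
have : m%:R *: (m`!%:R *: degree_proj tree_act V m x) \in lie_trees.
  rewrite -E scaler_sumr; under eq_bigr => U _ do rewrite (blow_rel_bracket_coef U (rel U)).
  under eq_bigr => U _ do rewrite exchange_big.
  rewrite exchange_big big_seq rpred_sum // => w ww.
  exact: word_coef_lie.
rewrite scalerA => H; have mm : m%:R * m`!%:R != 0 :> k.
  by rewrite mulf_neq0 ?natr_neq0 ?fact_gt0.
by rewrite -[degree_proj _ _ _ _]scale1r -(mulVf mm) -scalerA rpredZ.
Qed.

End KernelInImage.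

(** * Recovering words from ladders *)

Section Injectivity.
Variables (k : fieldType) (V : lmodType k).

Lemma word_upd_linear n (u : seq 'I_n) (v : {ffun 'I_n -> V}) i (a : k) (x y : V) :
  uniq u -> i \in u ->
  word (map (upd v i (a *: x + y)) u)
  = a *: word (map (upd v i x) u) + word (map (upd v i y) u).
Proof.
move=> uu iu; have [b [c E]] : exists b c, u = b ++ i :: c.
  by case/splitPr: iu => b c; exists b, c.
have ibc : i \notin b ++ c.
  by move: uu; rewrite E uniq_catC cons_uniq mem_cat => /andP[]; rewrite mem_cat orbC.
have upd_notin s z : i \notin s -> map (upd v i z) s = map v s.
  move=> is_; apply/eq_in_map => j js; rewrite ffunE.
  by case: eqP => // ji; rewrite -ji js in is_.
have M z : map (upd v i z) u = map v b ++ z :: map v c.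
  move: ibc; rewrite mem_cat negb_or => /andP[ib ic].
  by rewrite E map_cat /= !upd_notin // ffunE eqxx.
by rewrite !M word_linear.
Qed.

Lemma ladder_relabel n (s : {perm 'I_n}) u : u \in permutations (enum 'I_n) ->
  ladder (map s u) = relabel_fun (ladder u) s.
Proof.
move=> uw; apply/ffunP => x; rewrite -[x](permKV s); set y := (s^-1%g x).
rewrite !ffunE permK /= index_map; last exact: perm_inj.
case: eqP => //= _; congr Some; rewrite (nth_map y) //.
have yu : (index y u < size u)%N.
  by rewrite index_mem; move: uw; rewrite mem_permutations => /perm_mem ->; rewrite mem_enum.
exact: leq_ltn_trans (leq_pred _) yu.
Qed.

Definition ladder_word_gen n (T : Tree n) (v : {ffun 'I_n -> V}) : words V :=
  \sum_(u <- permutations (enum 'I_n) | ladder u == val T) word (map v u).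

Lemma ladder_word_linear n (T : Tree n) v i (a : k) (x y : V) :
  ladder_word_gen T (upd v i (a *: x + y))
  = a *: ladder_word_gen T (upd v i x) + ladder_word_gen T (upd v i y).
Proof.
rewrite /ladder_word_gen scaler_sumr -big_split big_seq_cond [RHS]big_seq_cond.
apply: eq_bigr => u /andP[]; rewrite mem_permutations => uE _.
by apply: word_upd_linear; rewrite ?(perm_uniq uE) ?(perm_mem uE) ?enum_uniq ?mem_enum.
Qed.

Lemma ladder_word_balanced n (T : Tree n) v (s : {perm 'I_n}) :
  ladder_word_gen (tree_act n T s) v = ladder_word_gen T [ffun j => v (s j)].
Proof.
rewrite /ladder_word_gen (orders_reindex s) big_seq_cond [RHS]big_seq_cond.
apply: eq_big => [u|u _]; last first.
  by rewrite -map_comp; congr word; apply: eq_map => j; rewrite ffunE.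
case uw: (u \in _) => //=; rewrite ladder_relabel //.
exact: (inj_eq (@relabel_fun_inj _ s)).
Qed.

Definition ladder_word : {linear Tr V -> words V} :=
  deco_lift ladder_word_linear ladder_word_balanced.

(** The ladder u is increasing only if u is the identity.  The empty word is excluded since
    there is no empty tree. *)
Lemma ladder_word_grow (s : seq V) : s != [::] -> ladder_word (grow V (word s)) = word s.
Proof.
move=> s0; pose n := size s; pose v : {ffun 'I_n -> V} := [ffun i : 'I_n => s`_i].
have Es : map v (enum 'I_n) = s by apply: map_ffun_nth.
rewrite -Es; have ew : enum 'I_n \in permutations (enum 'I_n) by rewrite mem_permutations.
have n0 : (0 < n)%N by rewrite lt0n size_eq0.
rewrite grow_word // linear_sum.
transitivity (\sum_(T : Tree n | linext (parent T) (enum 'I_n)) ladder_word_gen T v).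
  by apply: eq_bigr => T _; apply: deco_liftE.
rewrite /ladder_word_gen (exchange_big_dep xpredT) //=.
rewrite (bigD1_seq (enum 'I_n)) ?permutations_uniq //=.
rewrite [X in _ + X]big_seq_cond [X in _ + X]big1 ?addr0.
  rewrite (big_pred1 (mk_rtree (is_rtree_tent n0 ew))) // => T.
  apply/andP/eqP => [[_ /eqP E]|->]; first by apply: val_inj.
  by rewrite eqxx; split=> //; rewrite [linext _ _](linext_ladder ew ew).
move=> u /andP[uw ue]; rewrite big_pred0 // => T; apply/negP => /andP[+ /eqP E].
have -> : linext (parent T) (enum 'I_n) = linext (ladder u) (enum 'I_n) by rewrite E.
by rewrite linext_ladder // (negPf ue).
Qed.

Lemma ladder_word_lie (r : seq V) :
  ladder_word (grow V (expand V (left_normed r))) = expand V (left_normed r).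
Proof.
rewrite grow_expand_left_normed bracket_sum_linear expand_left_normed.
have [->//|r0] := eqVneq r [::].
apply: eq_bracket_sum => u ur; apply: ladder_word_grow.
by rewrite -size_eq0 (perm_size ur) size_eq0.
Qed.

End Injectivity.

(** * The isomorphism *)

Section LieToKernel.
Variables (k : fieldType).

Definition lie_to_tree (V : lmodType k) : {linear pL V -> Tr V} :=
  (grow V \o expand V : {linear pL V -> Tr V}).

Lemma lie_to_tree_kernel (V : lmodType k) x :
  x \in @L k V -> lie_to_tree V x \in kernel (delta V).
Proof.
move/L_left_normed; move: x; apply: lspan_ind => [|a x y dx dy|_ [r ->]].
- by rewrite linear0 rpred0.
- by rewrite linearP rpredD ?rpredZ.
- by apply/eqP; apply: delta_grow_left_normed.
Qed.

(** [ladder_word] undoes [grow], and [dynkin] undoes [expand]. *)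
Lemma lie_to_tree_inj (V : lmodType k) x : [pchar k] =i pred0 ->
  x \in @L k V -> dynkin V (ladder_word V (lie_to_tree V x)) = x.
Proof.
move=> char_k xL; rewrite -[RHS](dynkin_expand char_k xL); congr (dynkin _ _).
move/L_left_normed: xL; move: x; apply: lspan_ind => [|a x y dx dy|_ [r ->]].
- by rewrite !linear0.
- by rewrite !linearP dx dy.
- by rewrite -[RHS]ladder_word_lie.
Qed.

Lemma lie_to_tree_surj (V : lmodType k) y : [pchar k] =i pred0 ->
  y \in kernel (delta V) -> exists2 x, x \in @L k V & lie_to_tree V x = y.
Proof.
move=> char_k /(kernel_lie_trees char_k); move: y.
apply: lspan_ind => [|a y z [x xL <-] [x' xL' <-]|_ [r ->]].
- by exists 0; rewrite ?rpred0 ?linear0.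
- by exists (a *: x + x'); rewrite ?rpredD ?rpredZ ?linearP.
- by exists (left_normed r); rewrite ?left_normed_L.
Qed.

Lemma pL_map_left_normed (V W : lmodType k) (f : {linear V -> W}) r :
  pL_map f (left_normed r) = left_normed (map f r).
Proof.
elim: r => [|z r IH]; first exact: linear0.
have [->|r0] := eqVneq r [::]; first exact: pL_map_gen.
rewrite map_cons !left_normedS -?size_eq0 ?size_map ?size_eq0 // /lie_bracket.
by rewrite linearB !pL_map_star IH pL_map_gen.
Qed.

Lemma Tr_map_grow (V W : lmodType k) (f : {linear V -> W}) (s : seq V) :
  Tr_map f (grow V (word s)) = grow W (word (map f s)).
Proof.
pose n := size s; pose v : {ffun 'I_n -> V} := [ffun i : 'I_n => s`_i].
have Es : map v (enum 'I_n) = s by apply: map_ffun_nth.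
have ew : enum 'I_n \in permutations (enum 'I_n) by rewrite mem_permutations.
rewrite -{1}Es grow_word // linear_sum.
have -> : map f s = map [ffun j => f (v j)] (enum 'I_n).
  by rewrite -{1}Es -map_comp; apply: eq_map => j /=; rewrite [RHS]ffunE.
rewrite grow_word //; apply: eq_bigr => T _; exact: Tr_mapE.
Qed.

Lemma lie_to_tree_natural (V W : lmodType k) (f : {linear V -> W}) x :
  x \in @L k V -> lie_to_tree W (pL_map f x) = Tr_map f (lie_to_tree V x).
Proof.
move/L_left_normed; move: x; apply: lspan_ind => [|a x y dx dy|_ [r ->]].
- by rewrite !linear0.
- by rewrite !linearP dx dy.
rewrite pL_map_left_normed [LHS]grow_expand_left_normed [lie_to_tree V _]grow_expand_left_normed.
rewrite bracket_sum_linear bracket_sum_map; apply: eq_bracket_sum => u _.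
by rewrite Tr_map_grow.
Qed.

End LieToKernel.

Section Phi.
Variables (k : fieldType) (V : lmodType k).

Definition lie_ker (x : subspace (@L k V)) : subspace (kernel (@delta k V)) :=
  Subspace (lie_to_tree_kernel (valP x)).

Lemma lie_ker_linear : linear lie_ker.
Proof.
move=> a x y; apply: val_inj.
by rewrite -[LHS]/(lie_to_tree V (val (a *: x + y))) [RHS]linearP !linearP.
Qed.
HB.instance Definition _ := GRing.isLinear.Build k (subspace (@L k V))
  (subspace (kernel (@delta k V))) _ lie_ker lie_ker_linear.

Lemma lie_ker_bijective : [pchar k] =i pred0 -> bijective lie_ker.
Proof.
move=> char_k.
have inj : injective lie_ker.
  move=> x y /(congr1 val) /= E; apply: val_inj.
  rewrite -(lie_to_tree_inj char_k (valP x)) -(lie_to_tree_inj char_k (valP y)).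
  by rewrite [lie_to_tree _ _]E.
have surj y : exists x, lie_ker x = y.
  have [x xL E] := lie_to_tree_surj char_k (valP y).
  by exists (Subspace xL); apply: val_inj.
have [g gK] := choice surj.
by exists g => // x; apply: inj; rewrite gK.
Qed.
End Phi.

Theorem corollary4p9 (k : fieldType) (char_k : [pchar k] =i pred0) :
  exists phi : forall V : lmodType k,
      {linear subspace (@L k V) -> subspace (kernel (@delta k V))},
    (forall V : lmodType k, bijective (phi V)) /\
    (forall (V W : lmodType k) (f : {linear V -> W}) (x : subspace (@L k V)),
      phi W (L_map f x) = ker_delta_map f (phi V x)).
Proof.
exists (fun V => @lie_ker k V : {linear subspace (@L k V) -> subspace (kernel (@delta k V))});
  split=> [V|V W f x].
  exact: lie_ker_bijective.
by apply: val_inj; apply: lie_to_tree_natural (valP x).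
Qed.
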